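(* Suppose that $$\int_1^\infty g(\zeta)^{-1/m}\,\zeta^{1/m-1}\,d\zeta<\infty$$ and $$\liminf_{t\to+0} G(t)^{\,n-m}\,t<\infty,\qquad\text{where } G(t)=\int_t^\infty g(\zeta)^{-1/m}\,\zeta^{1/m-1}\,d\zeta,\quad t>0.$$ Then any global weak solution $u$ of the inequality $\sum_{|\alpha|=m}\partial^\alpha a_\alpha(x,u)\ge g(|u|)$ in $\mathbb{R}^n$ is trivial, i.e. $u=0$ almost everywhere in $\mathbb{R}^n$.
   Context: Let $m,n\ge 1$ be integers. For each multi-index $\alpha=(\alpha_1,\dots,\alpha_n)$ with $|\alpha|=\alpha_1+\dots+\alpha_n=m$, let $a_\alpha:\mathbb{R}^n\times\mathbb{R}\to\mathbb{R}$ be a Caratheodory function (measurable in $x$ for every $\zeta$, continuous in $\zeta$ for almost every $x$) such that, for some constant $A>0$, $|a_\alpha(x,\zeta)|\le A|\zeta|$ for almost all $x\in\mathbb{R}^n$ and all $\zeta\in\mathbb{R}$. Here $\partial^\alpha=\partial^{|\alpha|}/(\partial_{x_1}^{\alpha_1}\cdots\partial_{x_n}^{\alpha_n})$. Let $g:[0,\infty)\to\mathbb{R}$ be a non-decreasing convex function with $g(\zeta)>0$ for all $\zeta>0$. A function $u\in L_{1,loc}(\mathbb{R}^n)$ (real-valued) is called a global weak solution of $\sum_{|\alpha|=m}\partial^\alpha a_\alpha(x,u)\ge g(|u|)$ in $\mathbb{R}^n$ if $g(|u|)\in L_{1,loc}(\mathbb{R}^n)$ and $$\int_{\mathbb{R}^n}\sum_{|\alpha|=m}(-1)^m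 a_\alpha(x,u)\,\partial^\alpha\varphi\,dx\ge\int_{\mathbb{R}^n}g(|u|)\,\varphi\,dx$$ for every non-negative $\varphi\in C_0^\infty(\mathbb{R}^n)$. *)

(* Defs.v *)
From HB Require Import structures.
From mathcomp Require Import all_boot all_order all_algebra.
From mathcomp Require Import all_classical all_reals all_analysis.

Set Implicit Arguments.
Unset Strict Implicit.
Unset Printing Implicit Defensive.
Import Order.TTheory GRing.Theory Num.Theory.
Import numFieldNormedType.Exports.
Local Open Scope classical_set_scope.
Local Open Scope ring_scope.

(* R^n with the product sigma-algebra of n copies of the Borel sigma-algebra
   of R, that is, its Borel sigma-algebra. *)
Definition borel_rV (R : realType) (n : nat) : Type := 'rV[R]_n.

Section borel_rV.
Context (R : realType) (n : nat).

Definition rV_coord (i : 'I_n) (x : borel_rV R n) : measurableTypeR R :=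
  x ord0 i.

HB.instance Definition _ := Pointed.on (borel_rV R n).
HB.instance Definition _ := @isMeasurable.Build
  default_measure_display (borel_rV R n)
  (g_sigma_preimage rV_coord) (@sigma_algebra0 _ _ _)
  (@sigma_algebraC _ _) (@sigma_algebra_bigcup _ _ _).

Lemma measurable_rV_coord i : measurable_fun setT (rV_coord i).
Proof.
move=> _ Y mY; rewrite setTI; apply: sub_sigma_algebra => /=.
rewrite -bigcup_seq/=; exists i => /=; first by rewrite mem_index_enum.
by exists Y => //; rewrite setTI.
Qed.

Lemma measurable_fun_rVP d (T : measurableType d) (f : T -> borel_rV R n) :
  (forall i, measurable_fun setT (rV_coord i \o f)) -> measurable_fun setT f.
Proof.
move=> mf _ A mA.
have : preimage_set_system setT f (g_sigma_preimage rV_coord)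
    (setT `&` f @^-1` A) by exists A.
rewrite -g_sigma_preimage_comp => h.
apply: (smallest_sub _ _ h); first exact: sigma_algebra_measurable.
rewrite -bigcup_seq => B /= [i _] [C mC <-].
exact: (mf i).
Qed.

End borel_rV.

Section lebesgue_rV.
Context (R : realType).

Definition rV_cons n (p : borel_rV R n * measurableTypeR R) : borel_rV R n.+1 :=
  row_mx (p.2%:M : 'rV[R]_1) (p.1 : 'rV[R]_n).

Lemma rV_cons0 n p : rV_coord ord0 (@rV_cons n p) = p.2.
Proof.
rewrite /rV_coord /rV_cons.
have -> : ord0 = lshift n (ord0 : 'I_1) by exact: val_inj.
by rewrite [LHS](@row_mxEl R 1 1 n) mxE mulr1n.
Qed.

Lemma rV_consS n p (j : 'I_n) :
  rV_coord (lift ord0 j) (@rV_cons n p) = rV_coord j p.1.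
Proof.
rewrite /rV_coord /rV_cons.
have -> : lift ord0 j = rshift 1 j by exact: val_inj.
by rewrite [LHS](@row_mxEr R 1 1 n).
Qed.

Lemma measurable_rV_cons n : measurable_fun setT (@rV_cons n).
Proof.
apply: measurable_fun_rVP => i; case: (unliftP ord0 i) => [j|] ->.
  rewrite (_ : _ \o _ = @rV_coord R n j \o fst); last first.
    by apply/funext => p; exact: rV_consS.
  by apply: measurableT_comp => //; exact: measurable_rV_coord.
rewrite (_ : _ \o _ = snd); last by apply/funext => p; exact: rV_cons0.
exact: measurable_snd.
Qed.

Section lebesgue_cons.
Context n (mu : {measure set (borel_rV R n) -> \bar R}).

Definition lebesgue_cons : set (borel_rV R n.+1) -> \bar R :=
  pushforward (mu \x lebesgue_measure)%E (@rV_cons n).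

Let lebesgue_cons0 : lebesgue_cons set0 = 0%E.
Proof. by rewrite /lebesgue_cons measure0//; exact: measurable_rV_cons. Qed.

Let lebesgue_cons_ge0 A : (0 <= lebesgue_cons A)%E.
Proof. by apply: measure_ge0; exact: measurable_rV_cons. Qed.

Let lebesgue_cons_sigma_additive : semi_sigma_additive lebesgue_cons.
Proof.
by apply: measure_semi_sigma_additive; exact: measurable_rV_cons.
Qed.

HB.instance Definition _ := isMeasure.Build _ _ _ lebesgue_cons
  lebesgue_cons0 lebesgue_cons_ge0 lebesgue_cons_sigma_additive.

End lebesgue_cons.

Fixpoint lebesgue_borel n : {measure set (borel_rV R n) -> \bar R} :=
  match n with
  | 0 => @dirac _ (borel_rV R 0) (0 : 'rV[R]_0) R
  | n'.+1 => lebesgue_cons (lebesgue_borel n')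
  end.

Lemma measurable_rV_box n (A : 'I_n -> set (measurableTypeR R)) :
  (forall i, measurable (A i)) ->
  measurable [set x : borel_rV R n | forall i, A i (rV_coord i x)].
Proof.
move=> mA; have -> : [set x : borel_rV R n | forall i, A i (rV_coord i x)] =
    \bigcap_(i in [set: 'I_n]) (rV_coord i @^-1` A i).
  by apply/seteqP; split=> [x xA i _|x xA i]; exact: xA.
apply: fin_bigcap_measurable => // i _.
by rewrite -[X in measurable X]setTI; exact: measurable_rV_coord.
Qed.

Lemma lebesgue_borelE n (A : 'I_n -> set (measurableTypeR R)) :
  (forall i, measurable (A i)) ->
  lebesgue_borel n [set x | forall i, A i (rV_coord i x)] =
  (\prod_(i < n) lebesgue_measure (A i))%E.
Proof.
elim: n A => [|n ih] A mA /=.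
  by rewrite big_ord0 diracE mem_set// => -[].
rewrite /lebesgue_cons /pushforward big_ord_recl -ih// muleC.
rewrite -product_measure1E//; last first.
  by apply: (measurable_rV_box (A := fun i => A (lift ord0 i))) => i; exact: mA.
congr ((_ \x _)%E _); apply/seteqP; split=> [x /= xA|x /= [xA x0] i].
  split=> [i|]; first by rewrite -rV_consS.
  by rewrite -[x.2]rV_cons0.
by case: (unliftP ord0 i) => [j|] ->; rewrite ?rV_consS ?rV_cons0.
Qed.

End lebesgue_rV.

Arguments lebesgue_borel R n : clear implicits.

Definition lebesgue_rV_type (R : realType) (n : nat) : Type :=
  caratheodory_type ((lebesgue_borel R n)^*)%mu.

HB.instance Definition _ (R : realType) (n : nat) :=
  Measurable.on (lebesgue_rV_type R n).

(* Completion of the n-fold product of the one-dimensional Lebesgue measure;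
   its measurable sets are the Lebesgue measurable subsets of R^n. *)
Definition lebesgue_rV (R : realType) (n : nat) :
  set (lebesgue_rV_type R n) -> \bar R :=
  @completed_measure_extension _ _ _ (lebesgue_borel R n).

HB.instance Definition _ (R : realType) (n : nat) :=
  Measure.on (@lebesgue_rV R n).

Arguments lebesgue_rV R n : clear implicits.

Lemma lebesgue_rV_box (R : realType) (n : nat) (a b : 'rV[R]_n) :
  (forall i, a ord0 i <= b ord0 i) ->
  lebesgue_rV R n
    [set x : 'rV[R]_n | forall i, a ord0 i <= x ord0 i <= b ord0 i] =
  (\prod_(i < n) (b ord0 i - a ord0 i))%:E.
Proof.
move=> ab; rewrite /lebesgue_rV /completed_measure_extension.
have mi (i : 'I_n) :
    measurable (`[a ord0 i, b ord0 i]%classic : set (measurableTypeR R)).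
  exact: measurable_itv.
have -> : [set x : 'rV[R]_n | forall i, a ord0 i <= x ord0 i <= b ord0 i] =
    [set x | forall i, (`[a ord0 i, b ord0 i]%classic) (rV_coord i x)].
  by apply/seteqP; split=> x /= xab i; have := xab i; rewrite in_itv.
rewrite measurable_mu_extE; last first.
  exact: (measurable_rV_box (A := fun i => `[a ord0 i, b ord0 i]%classic)).
rewrite (lebesgue_borelE (A := fun i => `[a ord0 i, b ord0 i]%classic))//.
rewrite -prodEFin; apply: eq_bigr => i _.
rewrite lebesgue_measure_itv/= lte_fin.
case: ltP => [_|ba]; first by rewrite EFinB.
by rewrite (@le_anti _ _ (a ord0 i) (b ord0 i)) ?subrr// ab.
Qed.

Section weak_solutions.
Context (R : realType) (n : nat).
Implicit Types (f phi : 'rV[R]_n -> R).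
Local Notation mu := (lebesgue_rV R n).

Definition partial_deriv (i : 'I_n) f : 'rV[R]_n -> R :=
  fun x => 'D_(delta_mx ord0 i) f x.

Definition smooth f : Prop := forall s : seq 'I_n,
  continuous (foldr partial_deriv f s) /\
  forall i x, derivable (foldr partial_deriv f s) x (delta_mx ord0 i).

Definition test_function phi : Prop :=
  smooth phi /\ compact (closure [set x | phi x != 0]).

(* Multi-indices whose entries are at most m; this includes all those of
   order m. *)
Definition multi_index (m : nat) : Type := {ffun 'I_n -> 'I_m.+1}.

HB.instance Definition _ m := Finite.on (multi_index m).

Definition mi_order m (alpha : multi_index m) : nat :=
  (\sum_(i < n) alpha i)%N.

Definition partial_deriv_multi m (alpha : multi_index m) f : 'rV[R]_n -> R :=
  foldr (fun i => iter (alpha i) (partial_deriv i)) f (enum 'I_n).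

Definition locally_integrable_rV f : Prop :=
  measurable_fun [set: lebesgue_rV_type R n] f /\
  forall K : set 'rV[R]_n, compact K ->
    (\int[mu]_(x in K) `|f x|%:E < +oo)%E.

Definition caratheodory_function (a : 'rV[R]_n -> R -> R) : Prop :=
  (forall z, measurable_fun [set: lebesgue_rV_type R n] (a ^~ z)) /\
  {ae mu, forall x, continuous (a x)}.

Definition global_weak_solution m
    (a : multi_index m -> 'rV[R]_n -> R -> R) (g : R -> R)
    (u : 'rV[R]_n -> R) : Prop :=
  [/\ locally_integrable_rV u,
      locally_integrable_rV (fun x => g `|u x|) &
      forall phi, test_function phi -> (forall x, 0 <= phi x) ->
        (\int[mu]_x (g `|u x| * phi x)%:E <=
         \int[mu]_x (\sum_(alpha | mi_order alpha == m)
            (-1) ^+ m * a alpha x (u x) * partial_deriv_multi alpha phi x)%:E)%E].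

End weak_solutions.

Section keller_osserman.
Context (R : realType) (m : nat) (g : R -> R).

Definition KO_integrand (z : R) : R :=
  g z `^ (- m%:R^-1) * z `^ (m%:R^-1 - 1).

Definition KO_G (t : R) : R :=
  \int[lebesgue_measure]_(z in `]t, +oo[) KO_integrand z.

End keller_osserman.

(* Main.v *)
Require Import Defs.
From mathcomp Require Import all_boot all_order all_algebra.
From mathcomp Require Import all_classical all_reals all_analysis.
From mathcomp Require Import measurable_realfun ring lra.
Import Order.TTheory GRing.Theory Num.Theory.
Import numFieldNormedType.Exports.
Set Implicit Arguments.
Unset Strict Implicit.
Unset Printing Implicit Defensive.
Local Open Scope classical_set_scope.
Local Open Scope ring_scope.

(**
The proof follows the mass J(r) of g(|u|) in the cube Q_r = [-r, r]^n and shows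
that, as soon as J is positive somewhere, it grows too fast for the two conditions
on G to hold.

Testing the inequality with a smooth cutoff equal to 1 on Q_r and supported in
Q_(r+h), all of whose derivatives of order m are O(h^-m) and live in the shell
Q_(r+h) \ Q_r, gives
  J(r) <= K h^-m * (integral of |u| over the shell)
([weak_solution_source_mass]). On the right |u| can be traded for g(|u|): since g
is convex with g(0) >= 0, the ratio g(z)/z is nondecreasing up to a factor 2 from
some level z1 on ([convex_quasi_superlinear]), hence g(|u|) dominates an affine
function of |u| vanishing at any prescribed level z0 >= z1, with slope
g(z0)/(2 z0). If z0 is at most a small multiple of the mean of |u| over the shell,
this yields
  J(r+h) >= J(r) (1 + c h^m g(z0)/z0)
for R <= r < r+h <= 2R and z0 <= c h^(m-1) R^(1-n) J(r)
([source_massR_growth]).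

Put w(z) = (z/g(z))^(1/m), which is z times the Keller-Osserman integrand, so that
the sum of w(2^k z) over k is at most 2 G(z/2) ([KO_G_dyadic_sum]). Starting at
r = R, take steps
  h_k = R/(4 2^k) + C w(2^k z).
The second term makes J gain a factor 2^m at each step; the first one keeps the
level 2^k z admissible, because h_k^(m-1) loses at most a factor 2^(m-1) per step
while J gains 2^m. If 8 (1 + 1/c) G(z/2) <= R, all the steps fit inside [R, 2R],
and J(2R) would be infinite. Therefore R < 8 (1 + 1/c) G(z/2) whenever
z R^n <= c 4^(1-m) R^m J(R) ([doubling_bound]).

It remains to let R tend to infinity. When g(0) > 0 we have J(R) >= g(0) (2R)^n,
and when n <= m and g(0) = 0 we have J(R) >= J(r0) > 0; either way a fixed z is
admissible for all large R, which is absurd ([no_uniform_lower_bound]). When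
n > m and g(0) = 0, the claim is that G(t)^(n-m) t tends to infinity as t -> 0+,
contradicting the assumption on the lower limit ([near0_KO_G_unbounded]). The
substitution t = kappa R^(m-n) reduces it to G(kappa R^(m-n)) >= rho R for all
large R, with rho^(n-m) kappa as large as desired. If J is unbounded, this is
the doubling bound, with kappa proportional to an arbitrarily large value of J.
If J is bounded, J(2R) - J(R) -> 0, and one growth step with r = h = R forces
z/g(z) >= (2 rho R)^m at z = 2 kappa R^(m-n), with rho arbitrary; a single dyadic
block of the integral G is then large enough.
*)

(** * A smooth step function *)

Section smooth_step.
Context {R : realType}.
Implicit Types (f : R -> R) (x t : R).

(** The functions x^-k exp(-1/x), extended by 0 to x <= 0, are taken for all k at
    once because differentiation maps this family into its linear span. *)
Definition flat_exp (k : nat) x : R :=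
  if 0 < x then x ^- k * expR (- x^-1) else 0.

Lemma flat_exp_gt0 k x : 0 < x -> 0 < flat_exp k x.
Proof.
by move=> x0; rewrite /flat_exp x0 mulr_gt0 ?expR_gt0// invr_gt0 exprn_gt0.
Qed.

Lemma flat_exp_ge0 k x : 0 <= flat_exp k x.
Proof.
have [x0|x0] := ltP 0 x; first exact/ltW/flat_exp_gt0.
by rewrite /flat_exp ltNge x0.
Qed.

Lemma flat_exp_le0 k x : x <= 0 -> flat_exp k x = 0.
Proof. by move=> x0; rewrite /flat_exp ltNge x0. Qed.

(** From exp(1/x) >= x^-(k+2)/(k+2)!: near the origin the exponential beats every power
    of 1/x. *)
Lemma flat_exp_le k x : flat_exp k x <= (k.+2)`!%:R * x ^+ 2.
Proof.
have f0 : (0 : R) < (k.+2)`!%:R by rewrite ltr0n fact_gt0.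
have [x0|x0] := ltP 0 x; last first.
  by rewrite flat_exp_le0// mulr_ge0 ?sqr_ge0// ltW.
rewrite /flat_exp x0 expRN.
have xk : 0 < x ^+ k by rewrite exprn_gt0.
rewrite -(ler_pM2l xk) mulrA mulfV ?gt_eqF// mul1r.
rewrite mulrCA -exprD addn2.
have h : x^-1 ^+ k.+2 / (k.+2)`!%:R <= expR x^-1.
  apply: le_trans (expR_ge1Dxn k.+1 _); last by rewrite invr_ge0 ltW.
  by rewrite lerDr.
rewrite -[leRHS]invrK lef_pV2 ?posrE ?expR_gt0//; last first.
  by rewrite invr_gt0 mulr_gt0 // exprn_gt0.
by rewrite invfM mulrC -exprVn.
Qed.

Lemma continuous_flat_exp0 k : {for 0, continuous (flat_exp k)}.
Proof.
rewrite /prop_for /continuous_at flat_exp_le0//.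
apply: (@squeeze_cvgr _ _ _ _ (cst 0) (fun x => (k.+2)`!%:R * x ^+ 2)).
- by apply: nearW => x; rewrite /= flat_exp_ge0 flat_exp_le.
- exact: cvg_cst.
- rewrite [X in _ --> X](_ : _ = (k.+2)`!%:R * (0 : R) ^+ 2); last first.
    by rewrite expr0n mulr0.
  by apply: cvgMr; exact: exprn_continuous.
Qed.

(** At the origin the difference quotient of [flat_exp k] is [flat_exp k.+1], which
    tends to 0. *)
Lemma is_derive_flat_exp k x :
  is_derive x 1 (flat_exp k) (flat_exp k.+2 x - k%:R * flat_exp k.+1 x).
Proof.
have [x0|x0|->] := ltgtP x 0; last first.
- rewrite !flat_exp_le0// mulr0 subr0.
  apply/is_derive1_caratheodory; exists (flat_exp k.+1); split => //.
  + move=> z; rewrite [flat_exp k 0]flat_exp_le0// !subr0.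
    have [z0|z0] := ltP 0 z; last by rewrite !flat_exp_le0// mul0r.
    by rewrite /flat_exp z0 [RHS]mulrAC exprS invfM [z^-1 * _]mulrC
      -(mulrA (z ^- k)) mulVf ?gt_eqF// mulr1.
  + exact: continuous_flat_exp0.
  + exact: flat_exp_le0.
- have xn0 : x != 0 by rewrite gt_eqF.
  apply: (@near_eq_is_derive _ _ _ (fun y : R => y ^- k * expR (- y^-1) : R)).
    near=> y; rewrite /flat_exp ifT//; near: y; exact: lt_nbhsr.
  have xk0 : x ^+ k != 0 by rewrite expf_neq0.
  have d1 : is_derive x (1:R) (fun y : R => y ^- k)
      (- (x ^+ k) ^- 2 *: (k%:R * x ^+ k.-1)).
    apply: is_deriveV => //.
    by apply: DeriveDef; [exact: exprn_derivable|
      rewrite exp_derive /GRing.scale/= mulr1].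
  have d2 : is_derive x (1:R) (fun y : R => expR (- y^-1))
      (expR (- x^-1) * (- (- x ^- 2 *: 1))).
    apply: (@is_derive1_comp _ expR (fun y => - y^-1)).
    apply: is_deriveN; exact: is_deriveV.
  refine (@is_derive_eq _ _ _ _ _ _ _ _ (is_deriveM d1 d2) _).
  rewrite /flat_exp x0 /GRing.scale/= mulr1.
  case: k xk0 {d1} => [|k] xk0 /=.
    by rewrite expr0 invr1 mul1r opprK !(mul0r, mulr0) subr0 addr0 mulrC.
  have xk : x ^+ k != 0 by rewrite expf_neq0.
  set E := expR _; rewrite !exprS; move: (x ^+ k) xk E => y y0 E; field.
  by rewrite y0 xn0.
- rewrite !(flat_exp_le0 _ (ltW x0)) mulr0 subr0.
  refine (near_eq_is_derive _ (is_derive_cst (0 : R) x (1 : R))).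
  near=> y; rewrite flat_exp_le0//; apply/ltW; near: y; exact: lt_nbhsl.
Unshelve. all: by end_near. Qed.

(** Smoothness is obtained by closing the flat exponentials under the operations used
    to build the step function: each rule differentiates into the class again, so
    every member has derivatives of all orders. *)
Inductive smooth_class : (R -> R) -> Prop :=
| smooth_cst c : smooth_class (fun=> c)
| smooth_flat k a b : smooth_class (fun x => flat_exp k (a * x + b))
| smooth_add f g : smooth_class f -> smooth_class g ->
    smooth_class (fun x => f x + g x)
| smooth_mul f g : smooth_class f -> smooth_class g ->
    smooth_class (fun x => f x * g x)
| smooth_inv f : (forall x, f x != 0) -> smooth_class f ->
    smooth_class (fun x => (f x)^-1).

Lemma is_derive1_affine a b x : is_derive x 1 (fun y : R => a * y + b) a.
Proof.
have h1 : is_derive x (1 : R) (fun y : R => a * y) a.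
  apply: is_derive_eq.
  by rewrite /GRing.scale/= mulr1.
have := @is_deriveD _ _ _ _ _ _ _ _ _ h1 (is_derive_cst b x (1 : R)).
by rewrite addr0.
Qed.

Lemma smooth_class_is_derive f : smooth_class f ->
  exists2 f', smooth_class f' & forall x, is_derive x 1 f (f' x).
Proof.
elim=> {f} [c|k a b|f g _ [f' sf' df] _ [g' sg' dg]|
    f g sf [f' sf' df] sg [g' sg' dg]|f f0 sf [f' sf' df]].
- by exists (fun=> 0); [exact: smooth_cst|move=> x; exact: is_derive_cst].
- exists (fun x => (flat_exp k.+2 (a * x + b) +
      - k%:R * flat_exp k.+1 (a * x + b)) * a) => [|x].
    apply: smooth_mul; last exact: smooth_cst.
    apply: smooth_add; first exact: smooth_flat.
    by apply: smooth_mul; [exact: smooth_cst|exact: smooth_flat].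
  rewrite mulNr; apply: (@is_derive1_comp _ (flat_exp k) (fun y => a * y + b)).
    exact: is_derive_flat_exp.
  exact: is_derive1_affine.
- exists (fun x => f' x + g' x); first exact: smooth_add.
  by move=> x; exact: (@is_deriveD _ _ _ _ _ _ _ _ _ (df x) (dg x)).
- exists (fun x => f x * g' x + g x * f' x).
    by apply: smooth_add; exact: smooth_mul.
  by move=> x; exact: (@is_deriveM _ _ _ _ _ _ _ _ (df x) (dg x)).
- exists (fun x => - 1 * ((f x)^-1 * (f x)^-1) * f' x).
    apply: smooth_mul => //; apply: smooth_mul; first exact: smooth_cst.
    by apply: smooth_mul; exact: smooth_inv.
  move=> x; rewrite mulN1r -invfM -expr2; exact: (is_deriveV (f0 x) (df x)).
Qed.

Lemma smooth_class_derive1n f k : smooth_class f -> smooth_class (derive1n k f).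
Proof.
move=> sf; elim: k => //= k /smooth_class_is_derive[f' sf' df].
rewrite (_ : derive1 _ = f')//; apply/funext => x; rewrite derive1E.
by have dx := df x; rewrite derive_val.
Qed.

Lemma is_derive_derive1n f k x : smooth_class f ->
  is_derive x 1 (derive1n k f) (derive1n k.+1 f x).
Proof.
move=> /(smooth_class_derive1n k)/smooth_class_is_derive[f' _ df].
have dx := df x; have -> // : derive1n k.+1 f x = f' x.
by rewrite [LHS]derive1E derive_val.
Qed.

(** The usual quotient e(x) / (e(x) + e(1 - x)), rescaled so that the transition takes
    place in [1/4, 3/4]: the derivatives then vanish at the endpoints 0 and 1 because
    the function is locally constant there. *)
Definition smooth_step x : R :=
  flat_exp 0 (2 * x + - 2^-1) *
  (flat_exp 0 (2 * x + - 2^-1) + flat_exp 0 (- 2 * x + 3 / 2))^-1.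

Lemma smooth_step_den_gt0 x :
  0 < flat_exp 0 (2 * x + - 2^-1) + flat_exp 0 (- 2 * x + 3 / 2).
Proof.
have [x0|x0] := ltP 4^-1 x.
  by apply: ltr_wpDr; [exact: flat_exp_ge0|apply: flat_exp_gt0; lra].
by apply: ltr_wpDl; [exact: flat_exp_ge0|apply: flat_exp_gt0; lra].
Qed.

Lemma smooth_step_class : smooth_class smooth_step.
Proof.
apply: smooth_mul; first exact: smooth_flat.
apply: smooth_inv => [x|]; first by rewrite gt_eqF// smooth_step_den_gt0.
by apply: smooth_add; exact: smooth_flat.
Qed.

Lemma smooth_step_itv x : 0 <= smooth_step x <= 1.
Proof.
have d0 := smooth_step_den_gt0 x.
rewrite /smooth_step mulr_ge0 ?flat_exp_ge0 ?invr_ge0 ?(ltW d0)//=.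
by rewrite ler_pdivrMr// mul1r lerDl flat_exp_ge0.
Qed.

Lemma smooth_step0 x : x <= 4^-1 -> smooth_step x = 0.
Proof. by move=> x4; rewrite /smooth_step flat_exp_le0 ?mul0r//; lra. Qed.

Lemma smooth_step1 x : 3 / 4 <= x -> smooth_step x = 1.
Proof.
move=> x4; have := smooth_step_den_gt0 x.
rewrite /smooth_step [flat_exp 0 (- 2 * x + _)]flat_exp_le0 ?addr0; last lra.
by move=> d0; rewrite mulfV// gt_eqF.
Qed.

Lemma smooth_step_derive1n0 k x : (0 < k)%N -> (x < 4^-1) || (3 / 4 < x) ->
  derive1n k smooth_step x = 0.
Proof.
case: k => // k _ xout.
have [c hc] : exists c, \near x, derive1n k smooth_step x = c.
  elim: k => [|k [c hc]].
    case/orP: xout => h; [exists 0|exists 1].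
      by near=> y; apply: smooth_step0; apply/ltW; near: y; exact: lt_nbhsl.
    by near=> y; apply: smooth_step1; apply/ltW; near: y; exact: lt_nbhsr.
  have {}hc := nbhs_interior hc.
  exists 0; near=> y.
  have hcy : \near y, cst c y = derive1n k smooth_step y.
    near: y; apply: filterS hc => y hy.
    by apply: filterS hy => z /= ->.
  have := near_eq_is_derive hcy (is_derive_cst c y (1 : R)) => dy.
  by rewrite derive1nS derive1E derive_val.
have hcx : \near x, cst c x = derive1n k smooth_step x.
  by apply: filterS hc => z /= ->.
have := near_eq_is_derive hcx (is_derive_cst c x (1 : R)) => dx.
by rewrite derive1nS derive1E derive_val.
Unshelve. all: by end_near. Qed.

(** A derivative of positive order is continuous and vanishes outside [0, 1]. *)
Lemma smooth_step_bounded k : exists M, forall x, `|derive1n k smooth_step x| <= M.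
Proof.
case: k => [|k].
  by exists 1 => x; have /andP[h1 h2] := smooth_step_itv x; rewrite ger0_norm.
have cf : continuous (fun x => `|derive1n k.+1 smooth_step x|).
  move=> x; apply: continuous_comp; last exact: norm_continuous.
  have dx := is_derive_derive1n k.+1 x smooth_step_class.
  by have /derivable1_diffP/differentiable_continuous := @ex_derive _ _ _ _ _ _ _ dx.
have [c _ hc] := EVT_max (ler01 : (0 : R) <= 1) (continuous_subspaceT cf).
exists `|derive1n k.+1 smooth_step c| => x.
have [xi|] := boolP (x \in `[0, 1]); first exact: hc.
rewrite in_itv/= negb_and -!ltNge => xo.
rewrite -derive1nS; have -> : derive1n k.+1 smooth_step x = 0.
  apply: smooth_step_derive1n0 => //.
  by case/orP: xo => h; apply/orP; [left|right]; lra.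
by rewrite normr0 normr_ge0.
Qed.

Lemma smooth_step_boundedn m : exists M, 1 <= M /\
  forall k x, (k <= m)%N -> `|derive1n k smooth_step x| <= M.
Proof.
elim: m => [|m [M [M1 hM]]].
  have [M hM] := smooth_step_bounded 0; exists (Num.max 1 M).
  by split=> [|[]// x _]; rewrite le_max ?lexx// hM orbT.
have [N hN] := smooth_step_bounded m.+1; exists (Num.max M N).
split=> [|k x]; first by rewrite le_max M1.
rewrite leq_eqVlt => /predU1P[->|km]; first by rewrite le_max hN orbT.
by rewrite le_max hM.
Qed.

End smooth_step.

(** * Smooth cutoffs between two cubes *)

Section cutoff.
Context {R : realType}.
Variables (r h : R).
Implicit Types (t : R) (k : nat).

(** The k-th derivative of t |-> S((t + r + h)/h) - S((t - r)/h) for the step S. A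
    difference of two steps, rather than a product, keeps every derivative a plain
    difference, so that no Leibniz formula is needed for the bounds. *)
Definition cutoff1 k t : R :=
  h ^- k * (derive1n k smooth_step (h^-1 * t + (r + h) / h) -
            derive1n k smooth_step (h^-1 * t + - (r / h))).

Lemma is_derive_cutoff1 k t : is_derive t 1 (cutoff1 k) (cutoff1 k.+1 t).
Proof.
pose F c (s : R) := derive1n k smooth_step (h^-1 * s + c).
have dF c : is_derive t 1 (F c) (derive1n k.+1 smooth_step (h^-1 * t + c) * h^-1).
  apply: (@is_derive1_comp _ (derive1n k smooth_step) (fun y => h^-1 * y + c)).
    exact/is_derive_derive1n/smooth_step_class.
  exact: is_derive1_affine.
have dB := @is_deriveB _ _ _ _ _ _ _ _ _ (dF ((r + h) / h)) (dF (- (r / h))).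
have dZ := @is_deriveZ _ _ _ _ (h ^- k) _ _ _ dB.
refine (@is_derive_eq _ _ _ _ _ _ _ _ dZ _).
rewrite /cutoff1 /GRing.scale/= exprS invfM; ring.
Qed.

(** To the right of r the first step has already reached 1, and to the left of r the
    second one is still 0. *)
Lemma cutoff1_ge0 t : 0 < h -> 0 < r -> 0 <= cutoff1 0 t.
Proof. move=> h0 r0.
rewrite /cutoff1 expr0 invr1 mul1r /=.
have [tr|tr] := leP t r.
  rewrite [X in _ - X]smooth_step0 ?subr0; last first.
    apply: (@le_trans _ _ 0); last lra.
    by rewrite -(mulrC t) -mulrBl pmulr_lle0 ?invr_gt0// subr_le0.
  by have /andP[] := smooth_step_itv (h^-1 * t + (r + h) / h).
rewrite [X in X - _]smooth_step1 ?subr_ge0; last first.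
  apply: (@le_trans _ _ 1); first lra.
  by rewrite -(mulrC t) -mulrDl ler_pdivlMr// mul1r; lra.
by have /andP[] := smooth_step_itv (h^-1 * t + - (r / h)).
Qed.

Lemma cutoff1_out k t : 0 < h -> 0 < r -> r + h < `|t| -> cutoff1 k t = 0.
Proof. move=> h0 r0.
move=> rt; suff H : derive1n k smooth_step (h^-1 * t + (r + h) / h) =
    derive1n k smooth_step (h^-1 * t + - (r / h)).
  by rewrite /cutoff1 H subrr mulr0.
have [t0|t0] := leP 0 t.
  rewrite ger0_norm// in rt.
  have h1 : 1 <= h^-1 * t + - (r / h).
    by rewrite -(mulrC t) -mulrBl ler_pdivlMr// mul1r; lra.
  have h2 : 1 <= h^-1 * t + (r + h) / h.
    by rewrite -(mulrC t) -mulrDl ler_pdivlMr// mul1r; lra.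
  case: k => [|k]; first by rewrite /= !smooth_step1//; lra.
  by rewrite !smooth_step_derive1n0//; apply/orP; right; lra.
rewrite ltr0_norm// in rt.
have h1 : h^-1 * t + (r + h) / h <= 0.
  by rewrite -(mulrC t) -mulrDl pmulr_lle0 ?invr_gt0//; lra.
have h2 : h^-1 * t + - (r / h) <= 0.
  by rewrite -(mulrC t) -mulrBl pmulr_lle0 ?invr_gt0//; lra.
case: k => [|k]; first by rewrite /= !smooth_step0//; lra.
by rewrite !smooth_step_derive1n0//; apply/orP; left; lra.
Qed.

Lemma cutoff1_in t : 0 < h -> 0 < r -> `|t| <= r -> cutoff1 0 t = 1.
Proof. move=> h0 r0.
rewrite ler_norml => /andP[t1 t2].
rewrite /cutoff1 expr0 invr1 mul1r /= smooth_step1 ?smooth_step0 ?subr0//.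
  rewrite -(mulrC t) -mulrBl; apply: (@le_trans _ _ 0); last lra.
  by rewrite pmulr_lle0 ?invr_gt0//; lra.
rewrite -(mulrC t) -mulrDl; apply: (@le_trans _ _ 1); first lra.
by rewrite ler_pdivlMr// mul1r; lra.
Qed.

Lemma cutoff1_derive_in k t : 0 < h -> 0 < r -> (0 < k)%N -> `|t| <= r ->
  cutoff1 k t = 0.
Proof. move=> h0 r0.
rewrite ler_norml => k0 /andP[t1 t2].
rewrite /cutoff1 !smooth_step_derive1n0 ?subr0 ?mulr0//.
  apply/orP; left; rewrite -(mulrC t) -mulrBl; apply: (@le_lt_trans _ _ 0); last lra.
  by rewrite pmulr_lle0 ?invr_gt0//; lra.
apply/orP; right; rewrite -(mulrC t) -mulrDl; apply: (@lt_le_trans _ _ 1); first lra.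
by rewrite ler_pdivlMr// mul1r; lra.
Qed.

Lemma cutoff1_le k t M : 0 < h ->
  (forall x, `|derive1n k smooth_step x| <= M) ->
  `|cutoff1 k t| <= h ^- k * (2 * M).
Proof.
move=> h0 hM; rewrite /cutoff1 normrM ger0_norm ?invr_ge0 ?exprn_ge0 ?(ltW h0)//.
rewrite ler_pM2l ?invr_gt0 ?exprn_gt0//.
by rewrite mulr_natl mulr2n (le_trans (ler_normB _ _))// lerD.
Qed.

Lemma continuous_cutoff1 k : continuous (cutoff1 k).
Proof.
move=> t; have dt := is_derive_cutoff1 k t.
by have /derivable1_diffP/differentiable_continuous := @ex_derive _ _ _ _ _ _ _ dt.
Qed.

Context {n : nat}.
Implicit Types (kappa : 'I_n -> nat) (x : 'rV[R]_n).

(** The partial derivative of order [kappa] of the product of the cutoffs in the single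
    coordinates. *)
Definition cutoff_deriv kappa x : R := \prod_j cutoff1 (kappa j) (x ord0 j).

Lemma cutoff_deriv_line kappa x i t :
  cutoff_deriv kappa (t *: delta_mx ord0 i + x) =
  (\prod_(j | j != i) cutoff1 (kappa j) (x ord0 j)) *
  cutoff1 (kappa i) (t + x ord0 i).
Proof.
rewrite /cutoff_deriv (bigD1 i)//= mulrC; congr (_ * _); last first.
  by rewrite !mxE !eqxx mulr1.
by apply: eq_bigr => j ji; rewrite !mxE eqxx (negbTE ji) mulr0 add0r.
Qed.

Definition bump_at i kappa : 'I_n -> nat := fun j => (kappa j + (j == i))%N.

Lemma cutoff_deriv_derive kappa x i :
  derivable (cutoff_deriv kappa) x (delta_mx ord0 i) /\
  'D_(delta_mx ord0 i) (cutoff_deriv kappa) x = cutoff_deriv (bump_at i kappa) x.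
Proof.
set c := \prod_(j | j != i) cutoff1 (kappa j) (x ord0 j).
pose F t := c * cutoff1 (kappa i) (t + x ord0 i).
have dF : is_derive (0 : R) 1 F (c * cutoff1 (kappa i).+1 (x ord0 i)).
  have dA := is_derive1_affine 1 (x ord0 i) 0.
  have : is_derive (0 : R) 1
      (fun t => cutoff1 (kappa i) (t + x ord0 i)) (cutoff1 (kappa i).+1 (x ord0 i)).
    have := @is_derive1_comp _ (cutoff1 (kappa i))
      (fun y : R => 1 * y + x ord0 i) 0 _ _
      (is_derive_cutoff1 (kappa i) (1 * 0 + x ord0 i)) dA.
    rewrite mulr0 add0r mulr1.
    rewrite (_ : _ \o _ = (fun t => cutoff1 (kappa i) (t + x ord0 i)))//.
    by apply/funext => t /=; rewrite mul1r.
  move=> d1; exact: (@is_deriveZ _ _ _ _ c _ _ _ d1).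
have FE : (fun t : R => cutoff_deriv kappa (t *: delta_mx ord0 i + x)) = F.
  by apply/funext => t; rewrite cutoff_deriv_line.
split.
  apply: (proj2 (@derivable1P _ _ _ (cutoff_deriv kappa) x (delta_mx ord0 i))).
  by rewrite FE; exact: (@ex_derive _ _ _ _ _ _ _ dF).
transitivity ('D_1 F 0).
  rewrite /derive; set g1 := fun h => h^-1 *: _; set g2 := fun h => h^-1 *: _.
  suff -> : g1 = g2 by [].
  apply/funext => t; rewrite /g1 /g2 /= -FE addr0 scale0r add0r.
  by rewrite (_ : t%:A = t)//; exact: mulr1.
rewrite derive_val /cutoff_deriv [RHS](bigD1 i)//= mulrC /bump_at eqxx addn1.
by congr (_ * _); apply: eq_bigr => j ji; rewrite (negbTE ji) addn0.
Qed.

Lemma partial_deriv_cutoff kappa i :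
  partial_deriv i (cutoff_deriv kappa) = cutoff_deriv (bump_at i kappa).
Proof. by apply/funext => x; have [] := cutoff_deriv_derive kappa x i. Qed.

Lemma foldr_partial_deriv_cutoff kappa (s : seq 'I_n) :
  exists kappa', foldr (@partial_deriv R n) (cutoff_deriv kappa) s =
    cutoff_deriv kappa'.
Proof.
elim: s => [|i s [k' IH]] /=; first by exists kappa.
by exists (bump_at i k'); rewrite IH partial_deriv_cutoff.
Qed.

Lemma continuous_cutoff_deriv kappa : continuous (cutoff_deriv kappa).
Proof.
rewrite /cutoff_deriv => x.
apply: (continuous_big (op := fun a b : R => a * b)) => [|j _ {}x].
  exact: mul_continuous.
by apply: continuous_comp; [exact: coord_continuous|exact: continuous_cutoff1].
Qed.

Definition cutoff := cutoff_deriv (fun=> 0%N).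

(** Partial differentiation only shifts the multi-index [kappa], so iterated partial
    derivatives stay in the family [cutoff_deriv]. *)
Lemma smooth_cutoff : smooth cutoff.
Proof.
move=> s; have [k' ->] := foldr_partial_deriv_cutoff (fun=> 0%N) s.
split; first exact: continuous_cutoff_deriv.
by move=> i x; have [] := cutoff_deriv_derive k' x i.
Qed.

Lemma iter_partial_deriv_cutoff kappa i k :
  iter k (@partial_deriv R n i) (cutoff_deriv kappa) =
  cutoff_deriv (fun j => kappa j + k * (j == i))%N.
Proof.
elim: k => [|k IH] /=.
  by congr cutoff_deriv; apply/funext => j; rewrite mul0n addn0.
rewrite IH partial_deriv_cutoff; congr cutoff_deriv; apply/funext => j.
by rewrite /bump_at mulSn addnCA addnC.
Qed.

Lemma partial_deriv_multi_cutoff m (alpha : multi_index n m) :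
  partial_deriv_multi alpha cutoff = cutoff_deriv (fun j => alpha j : nat).
Proof.
rewrite /partial_deriv_multi /cutoff.
suff -> (s : seq 'I_n) :
    foldr (fun i => iter (alpha i) (@partial_deriv R n i))
      (cutoff_deriv (fun=> 0%N)) s =
    cutoff_deriv (fun j => \sum_(i <- s) alpha i * (j == i))%N.
  congr cutoff_deriv; apply/funext => j; rewrite big_enum/=.
  rewrite (bigD1 j)//= eqxx muln1 big1 ?addn0// => i ij.
  by rewrite eq_sym (negbTE ij) muln0.
elim: s => [|i s /= ->].
  by congr cutoff_deriv; apply/funext => j; rewrite big_nil.
rewrite iter_partial_deriv_cutoff; congr cutoff_deriv; apply/funext => j.
by rewrite big_cons addnC.
Qed.

End cutoff.

(** * Cubes and shells *)

Section cubes.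
Context {R : realType} {n : nat}.
Implicit Types (r h : R) (x : 'rV[R]_n).

Definition cube r : set 'rV[R]_n := [set x | forall i, `|x ord0 i| <= r].

Definition shell r h : set 'rV[R]_n := cube (r + h) `\` cube r.

Lemma cube_subset r s : r <= s -> cube r `<=` cube s.
Proof. by move=> rs x xr i; exact: le_trans (xr i) rs. Qed.

Lemma compact_cube r : compact (cube r).
Proof.
have -> : cube r = [set x | forall i, `[- r, r]%classic (x ord0 i)].
  apply/seteqP; split => x /= xr i; have := xr i; rewrite in_itv/= ler_norml//.
by apply: (@rV_compact _ _ (fun=> `[- r, r]%classic)) => _; exact: segment_compact.
Qed.

Lemma closed_cube r : closed (cube r).
Proof. by apply: compact_closed; [exact: norm_hausdorff|exact: compact_cube]. Qed.

Lemma cutoff_deriv_out r h kappa x : 0 < h -> 0 < r -> ~ cube (r + h) x ->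
  cutoff_deriv r h kappa x = 0.
Proof.
move=> h0 r0 /existsNP[i /negP]; rewrite -ltNge => xi.
by rewrite /cutoff_deriv (bigD1 i)//= cutoff1_out// mul0r.
Qed.

(** Some factor is differentiated at least once, and it vanishes on [-r, r]. *)
Lemma cutoff_deriv_in r h kappa x : 0 < h -> 0 < r ->
  (0 < \sum_j kappa j)%N -> cube r x -> cutoff_deriv r h kappa x = 0.
Proof.
move=> h0 r0; rewrite lt0n sum_nat_eq0 negb_forall => /existsP[i ki] xr.
by rewrite /cutoff_deriv (bigD1 i)//= cutoff1_derive_in ?mul0r// lt0n.
Qed.

Lemma cutoff_in r h x : 0 < h -> 0 < r -> cube r x -> cutoff r h x = 1.
Proof.
move=> h0 r0 xr; rewrite /cutoff /cutoff_deriv big1// => i _.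
by rewrite cutoff1_in.
Qed.

Lemma cutoff_ge0 r h x : 0 < h -> 0 < r -> 0 <= cutoff r h x.
Proof. by move=> h0 r0; apply: prodr_ge0 => i _; exact: cutoff1_ge0. Qed.

Lemma test_function_cutoff r h : 0 < h -> 0 < r ->
  test_function (cutoff r h : 'rV[R]_n -> R).
Proof.
move=> h0 r0; split; first exact: smooth_cutoff.
apply: (@subclosed_compact _ _ (cube (r + h))).
- exact: closed_closure.
- exact: compact_cube.
rewrite [X in _ `<=` X](closure_id _).1; last exact: closed_cube.
apply: closureS => x /= /eqP phi0; apply: contrapT => xr.
by apply: phi0; exact: cutoff_deriv_out.
Qed.

Lemma cutoff_deriv_le r h m M kappa x : 0 < h ->
  (forall k y, (k <= m)%N -> `|derive1n k smooth_step y : R| <= M) ->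
  (forall j, kappa j <= m)%N ->
  `|cutoff_deriv r h kappa x| <= h ^- (\sum_j kappa j) * (2 * M) ^+ n.
Proof.
move=> h0 hM km; rewrite /cutoff_deriv normr_prod.
have -> : h ^- (\sum_j kappa j) * (2 * M) ^+ n =
    \prod_(j < n) (h ^- kappa j * (2 * M)).
  by rewrite big_split/= prodr_const card_ord prodfV expr_sum.
apply: ler_prod => j _; rewrite normr_ge0/=.
by apply: cutoff1_le => // y; exact: hM.
Qed.

End cubes.

(** * Monotonicity of the integral for arbitrary functions *)

Section integral_comparison.
Context d (T : measurableType d) (R : realType) (mu : {measure set T -> \bar R}).
Implicit Types (f : T -> \bar R).
Local Open Scope ereal_scope.

(** The integral of a function is the difference of the suprema over simple functions
    below its positive and negative parts, so it is monotone for arbitrary functions.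
    This lets the composition of a coefficient with u be estimated as it stands. *)
Lemma integral_le_pointwise f1 f2 : (forall x, f1 x <= f2 x) ->
  \int[mu]_x f1 x <= \int[mu]_x f2 x.
Proof.
move=> f12; rewrite /integral; apply: leeB; apply: ge_ereal_sup => _ [h hf <-];
  apply: ereal_sup_ubound; exists h => // x; apply: le_trans (hf x) _.
- by rewrite !funeposE !patch_setT le_max2.
- by rewrite !funenegE !patch_setT le_max2// leeN2.
Qed.

(** Raise the larger function to +oo on an exceptional null set; its integral does not
    change and the inequality then holds everywhere. *)
Lemma integral_le_ae f1 f2 : measurable_fun setT f2 -> (forall x, 0 <= f2 x) ->
  {ae mu, forall x, f1 x <= f2 x} -> \int[mu]_x f1 x <= \int[mu]_x f2 x.
Proof.
move=> mf2 f20 [N [mN N0 subN]].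
(* N is measurable, which the set where the inequality fails need not be. *)
pose f3 x := maxe (f2 x) (((cst +oo) \_ N) x).
have mf3 : measurable_fun setT f3.
  apply: measurable_maxe => //.
  apply/(measurable_restrictT _ _).1 => //; exact: measurable_cst.
have -> : \int[mu]_x f2 x = \int[mu]_x f3 x.
  apply: ge0_ae_eq_integral => //.
    by move=> x _; rewrite /f3 le_max f20.
  exists N; split => // x /= /not_implyP[_ hx]; apply: contrapT => Nx.
  by apply: hx; rewrite /f3 patchC ?inE// max_l.
apply: integral_le_pointwise => x; rewrite /f3.
have [Nx|Nx] := pselect (N x).
  by rewrite patchT ?inE//= maxey leey.
by rewrite le_max; apply/orP; left; apply: contrapT => fx; exact/Nx/subN.
Qed.

End integral_comparison.

(** * Lebesgue measure of cubes and shells *)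

Section lebesgue_cube.
Context {R : realType} {n : nat}.
Local Notation mu := (lebesgue_rV R n).
Local Notation T := (lebesgue_rV_type R n).

Lemma ae_filter_rV : Filter (nbhs (almost_everywhere mu)).
Proof. exact: (@ae_filter_ringOfSetsType _ (lebesgue_rV_type R n) R mu). Qed.

Lemma measurable_cube (r : R) : measurable (cube r : set T).
Proof.
apply: caratheodory_measurable_mu_ext.
have -> : cube r = [set x : borel_rV R n | forall i, `[- r, r]%classic (rV_coord i x)].
  by apply/seteqP; split => x /= xr i; have := xr i; rewrite in_itv/= ler_norml.
exact: (measurable_rV_box (A := fun=> `[- r, r]%classic)).
Qed.

Lemma measurable_shell (r h : R) : measurable (shell r h : set T).
Proof. by apply: measurableD; exact: measurable_cube. Qed.

Lemma lebesgue_cube (r : R) : 0 <= r -> mu (cube r) = ((2 * r) ^+ n)%:E.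
Proof.
move=> r0; rewrite (_ : cube r = [set x | forall i,
  (const_mx (- r) : 'rV[R]_n) ord0 i <= x ord0 i <= (const_mx r : 'rV[R]_n) ord0 i]).
  rewrite lebesgue_rV_box => [|i]; last by rewrite !mxE; lra.
  under eq_bigr do rewrite !mxE opprK -mulr2n -mulr_natl.
  by rewrite prodr_const card_ord.
by apply/seteqP; split => x /= xr i; have := xr i; rewrite !mxE ler_norml.
Qed.

Lemma lebesgue_shell (r h : R) : 0 <= r -> 0 <= h ->
  mu (shell r h) = ((2 * (r + h)) ^+ n - (2 * r) ^+ n)%:E.
Proof.
move=> r0 h0; rewrite measureD; try exact: measurable_cube.
  rewrite setIidr; last by apply: cube_subset; rewrite lerDl.
  by rewrite [X in (X - _)%E]lebesgue_cube ?addr_ge0//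
    [X in (_ - X)%E]lebesgue_cube// EFinB.
by rewrite [ltLHS]lebesgue_cube ?addr_ge0// ltry.
Qed.

Lemma lebesgue_shell_le (r h s : R) : 0 <= r -> 0 <= h -> r + h <= s ->
  (mu (shell r h) <= (2 ^+ n * n%:R * s ^+ n.-1 * h)%:E)%E.
Proof.
move=> r0 h0 rhs; rewrite lebesgue_shell// lee_fin !exprMn -mulrBr -!mulrA.
rewrite ler_pM2l ?exprn_gt0// subrXX [r + h]addrC addrK mulrC mulrA.
rewrite ler_wpM2r//.
have -> : n%:R * s ^+ n.-1 = \sum_(i < n) s ^+ n.-1.
  by rewrite sumr_const card_ord mulr_natl.
apply: ler_sum => i _; have {2}-> : n.-1 = (n.-1 - i + i)%N.
  by rewrite subnK// -ltnS (ltn_predK (ltn_ord i)).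
rewrite exprD; apply: ler_pM; rewrite ?exprn_ge0 ?addr_ge0//.
  by apply: lerXn2r; rewrite ?nnegrE; lra.
by apply: lerXn2r; rewrite ?nnegrE; lra.
Qed.

End lebesgue_cube.

(** * Growth of the mass of the source term *)

Section growth.
Context {R : realType} {m n : nat}.
Local Notation mu := (lebesgue_rV R n).
Local Notation T := (lebesgue_rV_type R n).
Variables (a : multi_index n m -> 'rV[R]_n -> R -> R) (A : R) (g : R -> R).
Variable (u : 'rV[R]_n -> R).

Definition source_mass (r : R) : \bar R := (\int[mu]_(x in cube r) (g `|u x|)%:E)%E.

(** Test the inequality with [cutoff r h]: it is 1 on the inner cube, and its
    derivatives of order m > 0 vanish there and outside the outer cube. *)
Lemma weak_solution_source_mass : (0 < m)%N -> 0 < A ->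
  (forall alpha, mi_order alpha = m ->
      {ae mu, forall x, forall z, `|a alpha x z| <= A * `|z|}) ->
  (forall z, 0 <= z -> 0 <= g z) ->
  global_weak_solution a g u ->
  exists K, 0 < K /\ forall r h, 0 < r -> 0 < h ->
    (source_mass r <= (K * h ^- m)%:E * \int[mu]_(x in shell r h) `|u x|%:E)%E.
Proof.
move=> m0 A0 haA g0 [[mu_ _] _ hw].
have [M [M1 hM]] := @smooth_step_boundedn R m.
pose K := #|{: multi_index n m}|%:R * (A * (2 * M) ^+ n).
have M0 : 0 <= 2 * M by lra.
have card0 : (0 < #|{: multi_index n m}|)%N by apply/card_gt0P; exists [ffun=> ord0].
have K_gt0 : 0 < K by rewrite !mulr_gt0 ?ltr0n// exprn_gt0//; lra.
exists K; split => //.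
move=> r h r0 h0.
pose phi : 'rV[R]_n -> R := cutoff r h.
have := hw phi (test_function_cutoff h0 r0) (fun x => cutoff_ge0 x h0 r0).
move=> hphi.
have lower : (source_mass r <= \int[mu]_x (g `|u x| * phi x)%:E)%E.
  rewrite /source_mass integral_mkcond; apply: integral_le_pointwise => x.
  rewrite patchE; case: ifPn => [|_].
    by rewrite inE => xr; rewrite /phi cutoff_in// mulr1.
  by rewrite lee_fin mulr_ge0 ?g0// cutoff_ge0.
apply: le_trans lower _; apply: le_trans hphi _.
have K0 : 0 <= K * h ^- m.
  by rewrite ltW// mulr_gt0// invr_gt0 exprn_gt0.
have mau : measurable_fun [set: T] (fun x => `|u x|%:E).
  by apply/measurable_EFinP; apply: measurableT_comp.
rewrite -ge0_integralZl_EFin//; last 2 first.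
- exact: measurable_shell.
- exact: measurable_funS mau.
rewrite [leRHS]integral_mkcond; apply: integral_le_ae.
- apply/(measurable_restrictT _ _).1; first exact: measurable_shell.
  by apply: measurable_funeM; exact: measurable_funS mau.
- by move=> x; apply: erestrict_ge0 => y _; rewrite mule_ge0// lee_fin.
have FF := @ae_filter_rV R n.
have : {ae mu, forall x, forall alpha, mi_order alpha = m ->
    forall z, `|a alpha x z| <= A * `|z|}.
  apply: filter_forall => alpha.
  have [am|am] := eqVneq (mi_order alpha) m.
    by apply: filterS (haA _ am) => x ? _.
  by apply: aeW => x /eqP; rewrite (negbTE am).
apply: filterS => x hx.
have bound alpha : mi_order alpha == m ->
    `|(-1) ^+ m * a alpha x (u x) * partial_deriv_multi alpha phi x| <=
    A * `|u x| * (h ^- m * (2 * M) ^+ n).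
  move=> /eqP am; rewrite !normrM normrX normrN1 expr1n mul1r.
  apply: ler_pM => //; first exact: hx.
  rewrite /phi partial_deriv_multi_cutoff -[X in h ^- X]am.
  by apply: (cutoff_deriv_le _ _ h0 hM) => j; rewrite -ltnS.
rewrite patchE; case: ifPn => [_|].
  rewrite lee_fin; apply: le_trans (ler_norm _) _.
  apply: le_trans (ler_norm_sum _ _ _) _.
  apply: (@le_trans _ _
    (\sum_(alpha : multi_index n m) A * `|u x| * (h ^- m * (2 * M) ^+ n))).
    rewrite [leRHS](bigID (fun alpha => mi_order alpha == m))/=.
    apply: ler_wpDr; last exact: ler_sum.
    by apply: sumr_ge0 => ? _; rewrite !mulr_ge0 ?invr_ge0 ?exprn_ge0// ltW.
  rewrite sumr_const -[leLHS]mulr_natl /K.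
  rewrite (@eq_card _ _ {: multi_index n m})// le_eqVlt.
  by apply/orP; left; apply/eqP; ring.
rewrite notin_setE => xs; rewrite lee_fin big1// => alpha /eqP am.
rewrite /phi partial_deriv_multi_cutoff.
have [xr|xr] := pselect (cube r x).
  by rewrite cutoff_deriv_in ?mulr0// -[X in (_ < X)%N]/(mi_order alpha) am.
by rewrite cutoff_deriv_out ?mulr0// => xrh; exact: xs.
Qed.

(** The arithmetic of one growth step, with J and J' the masses in the inner and outer
    cubes, E and U the integrals of g(|u|) and |u| over the shell, and V its volume.
    The condition on z0 makes s z0 V at most half of s U. *)
Lemma growth_arith (K D c J J' U E V s g0 z0 h R0 : R) :
  0 < K -> 0 < D -> 0 <= U -> c = (4 * K * (D + 1))^-1 ->
  0 < h -> 0 < R0 -> 0 < z0 -> 0 <= g0 -> s = g0 / (2 * z0) -> (0 < m)%N -> (0 < n)%N ->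
  J <= K * h ^- m * U -> J' = J + E -> s * U <= E + s * z0 * V ->
  V <= D * R0 ^+ n.-1 * h -> z0 * R0 ^+ n <= c * h ^+ m.-1 * R0 * J ->
  J * (1 + c * h ^+ m * (g0 / z0)) <= J'.
Proof.
move=> K0 D0 U0 cE h0 R0_gt0 z00 g00 sE m0 n0 JU -> sU VD zJ.
have D1 : 0 < D + 1 by lra.
have c0 : 0 < c by rewrite cE invr_gt0 !mulr_gt0.
have hm : 0 < h ^+ m by rewrite exprn_gt0.
have JU' : h ^+ m * J <= K * U.
  rewrite -(ler_pM2l hm) in JU; apply: le_trans JU _.
  by rewrite le_eqVlt; apply/orP; left; apply/eqP; field; rewrite gt_eqF.
have s0 : 0 <= s by rewrite sE mulr_ge0// invr_ge0 mulr_ge0// ltW.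
have z1 : z0 * R0 ^+ n.-1 <= c * h ^+ m.-1 * J.
  rewrite -(ler_pM2r R0_gt0) [leRHS]mulrAC; apply: le_trans zJ.
  by rewrite -[in leRHS](prednK n0) exprSr mulrA.
have zV : z0 * V <= D * c * (h ^+ m * J).
  apply: (@le_trans _ _ (D * h * (z0 * R0 ^+ n.-1))).
    rewrite (_ : D * h * _ = z0 * (D * R0 ^+ n.-1 * h)); last ring.
    by rewrite ler_pM2l.
  rewrite (_ : D * c * _ = D * h * (c * h ^+ m.-1 * J)); last first.
    by rewrite -[in LHS](prednK m0) exprS; ring.
  by rewrite ler_pM2l// mulr_gt0.
have cKD : c * K * (D + 1) = 4^-1.
  by rewrite cE; field; rewrite !gt_eqF.
have hJU : c * (h ^+ m * J) <= c * K * U by rewrite -mulrA ler_pM2l.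
have zV2 : z0 * V <= 2^-1 * U.
  apply: le_trans zV _; rewrite -mulrA.
  apply: (@le_trans _ _ (D * (c * K * U))); first by rewrite ler_pM2l.
  rewrite mulrA ler_wpM2r//.
  have : 0 < c * K by rewrite mulr_gt0.
  nra.
have sz : s * z0 * V <= s * (2^-1 * U) by rewrite -mulrA ler_wpM2l.
have E1 : s * (2^-1 * U) <= E.
  have : s * U = s * (2^-1 * U) + s * (2^-1 * U) by field.
  lra.
rewrite mulrDr mulr1 lerD2l; apply: le_trans E1.
have -> : J * (c * h ^+ m * (g0 / z0)) = (2 * s) * (c * (h ^+ m * J)).
  by rewrite sE; field; rewrite gt_eqF.
apply: (@le_trans _ _ (2 * s * (c * K * U))); first by rewrite ler_wpM2l// mulr_ge0.
have -> : s * (2^-1 * U) = 2 * s * (4^-1 * U) by field.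
rewrite ler_wpM2l ?mulr_ge0// ler_wpM2r//.
have : 0 < c * K by rewrite mulr_gt0.
nra.
Qed.

Hypothesis g0 : forall z, 0 <= z -> 0 <= g z.
Hypothesis lu : locally_integrable_rV u.
Hypothesis lgu : locally_integrable_rV (fun x => g `|u x|).

Definition source_massR (r : R) : R := fine (source_mass r).

Let gu_ge0 x : (0 <= (g `|u x|)%:E)%E.
Proof. by rewrite lee_fin g0. Qed.

Lemma measurable_gu (D : set T) : measurable D ->
  measurable_fun D (fun x : T => (g `|u x|)%:E).
Proof. by move=> mD; apply/measurable_EFinP; apply: measurable_funTS; exact: lgu.1. Qed.

Lemma source_mass_ge0 r : (0 <= source_mass r)%E.
Proof. by apply: integral_ge0 => x _; exact: gu_ge0. Qed.

Lemma source_mass_fin_num r : source_mass r \is a fin_num.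
Proof.
rewrite ge0_fin_numE ?source_mass_ge0//.
apply: le_lt_trans (lgu.2 _ (@compact_cube R n r)); rewrite /source_mass.
rewrite le_eqVlt; apply/orP; left; apply/eqP; apply: eq_integral => x _.
by rewrite [in RHS]ger0_norm ?g0.
Qed.

Lemma source_massRE r : source_mass r = (source_massR r)%:E.
Proof. by rewrite fineK// source_mass_fin_num. Qed.

Lemma source_massR_ge0 r : 0 <= source_massR r.
Proof. by rewrite -lee_fin -source_massRE source_mass_ge0. Qed.

Lemma cubeU_shell r h : 0 <= h -> cube r `|` shell r h = cube (r + h) :> set 'rV[R]_n.
Proof.
move=> h0; apply/seteqP; split => [x [xr|[]//]|x xrh].
  by apply: cube_subset xr; rewrite lerDl.
by have [xr|xr] := pselect (cube r x); [left|right].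
Qed.

Lemma source_massD r h : 0 <= h ->
  source_mass (r + h) = (source_mass r + \int[mu]_(x in shell r h) (g `|u x|)%:E)%E.
Proof.
move=> h0; rewrite /source_mass -cubeU_shell//; apply: ge0_integral_setU => //.
- exact: measurable_cube.
- exact: measurable_shell.
- by apply: measurable_gu; apply: measurableU;
    [exact: measurable_cube|exact: measurable_shell].
- by apply/disj_setPS => x [xr []].
Qed.

Lemma source_massR_le r s : r <= s -> source_massR r <= source_massR s.
Proof.
move=> rs; rewrite -lee_fin -!source_massRE -[s](subrK r) addrC.
rewrite source_massD ?subr_ge0//.
by rewrite leeDl// integral_ge0.
Qed.

Lemma source_massR_lower c r : 0 <= r -> 0 <= c -> (forall z, 0 <= z -> c <= g z) ->
  c * (2 * r) ^+ n <= source_massR r.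
Proof.
move=> r0 c0 hc; rewrite -lee_fin -source_massRE EFinM -(lebesgue_cube r0).
rewrite -integral_cst; last exact: measurable_cube.
apply: ge0_le_integral => //; first exact: measurable_cube.
  by apply: measurable_gu; exact: measurable_cube.
by move=> x _; rewrite lee_fin hc.
Qed.

Lemma source_massR_eq0 : (forall z, 0 < z -> 0 < g z) ->
  (forall r, 0 < r -> source_massR r = 0) -> {ae mu, forall x, u x = 0}.
Proof.
move=> gpos J0.
have FF := @ae_filter_rV R n.
have h : {ae mu, forall x, forall k : nat, cube k.+1%:R x -> u x = 0}.
  apply: ae_foralln => k.
  have mc := @measurable_cube R n k.+1%:R.
  have /(ae_eq_integral_abs _ mc (measurable_gu mc)).1 :
      (\int[mu]_(x in cube k.+1%:R) `|(g `|u x|)%:E| = 0)%E.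
    rewrite -[RHS]/(0%:E) -(J0 k.+1%:R)// -source_massRE; apply: eq_integral => x _.
    by rewrite gee0_abs.
  apply: filterS => x hx xk; have [/eqP|u0] := eqVneq `|u x| 0.
    by rewrite normr_eq0 => /eqP.
  have := gpos `|u x|; have := hx xk; rewrite /cst => -[->].
  by rewrite lt_def u0 normr_ge0 ltxx => /(_ isT).
(* Every point lies in a cube with integer half-side. *)
apply: filterS h => x /(_ (Num.truncn (\sum_i `|x ord0 i|))); apply => i.
apply: (@le_trans _ _ (\sum_i `|x ord0 i|)).
  by rewrite (bigD1 i)//= lerDl sumr_ge0.
by apply/ltW; rewrite truncnS_gt.
Qed.

(** On the shell g(|u|) >= s (|u| - z0) with s = g(z0)/(2 z0): below the level z0 the
    right-hand side is negative, above it this is quasi-superlinearity. Integrating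
    gives Jensen's inequality up to constants, and [weak_solution_source_mass] bounds
    the integral of |u| from below. *)
Lemma source_massR_growth z1 : (0 < m)%N -> (0 < n)%N -> 0 < A ->
  (forall alpha, mi_order alpha = m ->
      {ae mu, forall x, forall z, `|a alpha x z| <= A * `|z|}) ->
  global_weak_solution a g u ->
  (forall z z', z1 <= z -> 0 < z -> z <= z' -> g z * z' <= 2 * (g z' * z)) ->
  exists c, 0 < c /\ forall R0 r h z0, 0 < R0 -> R0 <= r -> 0 < h -> r + h <= 2 * R0 ->
    0 < z0 -> z1 <= z0 -> z0 * R0 ^+ n <= c * h ^+ m.-1 * R0 * source_massR r ->
    source_massR r * (1 + c * h ^+ m * (g z0 / z0)) <= source_massR (r + h).
Proof.
move=> m0 n0 A0 haA hu quasi.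
have [K [K0 hK]] := weak_solution_source_mass m0 A0 haA g0 hu.
pose D : R := 2 ^+ n * n%:R * 2 ^+ n.-1.
have D0 : 0 < D by rewrite !mulr_gt0 ?exprn_gt0 ?ltr0n.
exists (4 * K * (D + 1))^-1; split; first by rewrite invr_gt0 !mulr_gt0 ?addr_gt0.
move=> R0 r h z0 R0_gt0 R0r h0 rh z00 z10 hz0.
have r0 : 0 < r by exact: lt_le_trans R0r.
have mS := @measurable_shell R n r h.
have mu_ : measurable_fun (shell r h : set T) (fun x : T => `|u x|%:E).
  by apply/measurable_EFinP; apply: measurableT_comp => //;
    apply: measurable_funTS; exact: lu.1.
pose Ue := (\int[mu]_(x in shell r h) `|u x|%:E)%E.
have Ue0 : (0 <= Ue)%E by apply: integral_ge0.
have Uefin : Ue \is a fin_num.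
  rewrite ge0_fin_numE//.
  apply: le_lt_trans (lu.2 _ (@compact_cube R n (r + h))).
  apply: ge0_subset_integral => //; first exact: measurable_cube.
    by apply/measurable_EFinP; apply: measurableT_comp => //;
    apply: measurable_funTS; exact: lu.1.
  by move=> x [].
pose Ee := (\int[mu]_(x in shell r h) (g `|u x|)%:E)%E.
have Ee0 : (0 <= Ee)%E by apply: integral_ge0.
have EE : source_mass (r + h) = (source_mass r + Ee)%E by rewrite source_massD// ltW.
have Eefin : Ee \is a fin_num.
  rewrite ge0_fin_numE//; apply: (@le_lt_trans _ _ (source_mass (r + h))).
    by rewrite EE leeDr// source_mass_ge0.
  by rewrite source_massRE ltry.
have Vfin : mu (shell r h) \is a fin_num by rewrite lebesgue_shell// ltW.
(* Half of the slope g z0 / z0, because g z / z is only almost nondecreasing. *)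
pose s := g z0 / (2 * z0).
have s0 : 0 <= s by rewrite mulr_ge0 ?g0 ?invr_ge0 ?mulr_ge0// ltW.
have pw z : 0 <= z -> s * z <= g z + s * z0.
  move=> zge0; have [zz|zz] := leP z0 z; last first.
    by apply: ler_wpDl; [exact: g0|rewrite ler_wpM2l// ltW].
  apply: ler_wpDr; first by rewrite mulr_ge0// ltW.
  rewrite /s mulrAC ler_pdivrMr ?mulr_gt0//.
  apply: le_trans (quasi _ _ z10 z00 zz) _; by rewrite mulrCA.
have key : (s%:E * Ue <= Ee + (s * z0)%:E * mu (shell r h))%E.
  rewrite -ge0_integralZl_EFin// -integral_cst// -ge0_integralD//; last 2 first.
  - exact: measurable_gu.
  - by move=> x _; rewrite /cst lee_fin mulr_ge0// ltW.
  apply: ge0_le_integral => //.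
  - by move=> x _; apply: mule_ge0; rewrite lee_fin.
  - exact: measurable_funeM.
  - by apply: emeasurable_funD => //; exact: measurable_gu.
  - by move=> x _; rewrite -EFinM -EFinD lee_fin pw.
apply: (@growth_arith K D _ _ _ (fine Ue) (fine Ee)
  (fine (mu (shell r h))) s (g z0) z0 h R0) => //.
- by rewrite fine_ge0.
- by apply: g0; exact: ltW.
- by rewrite -lee_fin -source_massRE EFinM fineK//; exact: hK.
- by apply: EFin_inj; rewrite EFinD -!source_massRE fineK.
- by rewrite -lee_fin EFinD !EFinM !fineK// -EFinM.
- rewrite -lee_fin fineK//; apply: le_trans (lebesgue_shell_le (ltW r0) (ltW h0) rh) _.
  by rewrite lee_fin exprMn /D le_eqVlt; apply/orP; left; apply/eqP; ring.
Qed.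

End growth.

(** * The Keller-Osserman integral *)

Section keller_osserman_function.
Context {R : realType} (m : nat) (g : R -> R).
Hypothesis m0 : (0 < m)%N.
Hypothesis g_mono : {in `[0, +oo[ &, {homo g : y z / y <= z}}.
Hypothesis g_pos : forall z, 0 < z -> 0 < g z.
Local Notation f := (KO_integrand m g).
Local Notation leb := (@lebesgue_measure R).

Let g_le y z : 0 <= y -> y <= z -> g y <= g z.
Proof.
by move=> y0 yz; apply: g_mono; rewrite ?in_itv ?andbT//= (le_trans y0).
Qed.

Lemma KO_integrand_ge0 z : 0 <= f z.
Proof. by rewrite mulr_ge0 ?powR_ge0. Qed.

Lemma KO_integrand_le x y : 0 < x -> x <= y -> f y <= f x.
Proof.
move=> x0 xy; have y0 : 0 < y by exact: lt_le_trans xy.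
have minv : 0 <= (m%:R : R)^-1 by rewrite invr_ge0.
have minv1 : (m%:R : R)^-1 <= 1 by rewrite invf_le1 ?ltr0n// ler1n.
have anti (p a b : R) : p <= 0 -> 0 < a -> a <= b -> b `^ p <= a `^ p.
  move=> p0 a0 ab; have b0 : 0 < b by exact: lt_le_trans ab.
  rewrite -(opprK p) (powRN a) (powRN b) lef_pV2 ?posrE ?powR_gt0//.
  by apply: ge0_ler_powR; rewrite ?nnegrE ?oppr_ge0 ?(ltW a0) ?(ltW b0).
apply: ler_pM; rewrite ?powR_ge0//.
  by apply: anti; [rewrite oppr_le0|exact: g_pos|apply: g_le => //; exact: ltW].
by apply: anti => //; rewrite subr_le0.
Qed.

(** So z times the integrand is (z/g(z))^(1/m), the natural length scale at level z. *)
Lemma KO_integrandX z : 0 < z -> (z * f z) ^+ m = z / g z.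
Proof.
move=> z0; have gz0 := g_pos z0.
have mm : (m%:R : R) != 0 by rewrite pnatr_eq0 -lt0n.
rewrite /KO_integrand mulrCA -[X in _ * (X * _)](powRr1 (ltW z0)) -powRD; last first.
  by rewrite (gt_eqF z0) implybT.
rewrite addrCA subrr addr0 exprMn -!powR_mulrn ?powR_ge0// -!powRrM mulNr.
by rewrite mulVf// powRN !powRr1 ?(ltW z0) ?(ltW gz0)// mulrC.
Qed.

Lemma measurable_KO_integrand t (D : set R) : 0 < t -> measurable D ->
  D `<=` `[t, +oo[ -> measurable_fun D (EFin \o f).
Proof.
move=> t0 mD Dt; apply/measurable_EFinP.
apply: (eq_measurable_fun (fun z => f (Num.max t z))).
  move=> z; rewrite inE => /Dt /=; rewrite in_itv/= andbT => tz.
  by rewrite max_r.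
apply: nonincreasing_measurable => // x y xy; apply: KO_integrand_le.
  by rewrite lt_max t0.
by rewrite ge_max le_max lexx/= le_max xy orbT.
Qed.

Hypothesis hint : (\int[leb]_(z in `[1%R, +oo[) (f z)%:E < +oo)%E.

Lemma KO_G_fin t : 0 < t -> (\int[leb]_(z in `]t, +oo[) (f z)%:E < +oo)%E.
Proof.
move=> t0; have [t1|t1] := leP 1 t.
  apply: le_lt_trans hint; apply: ge0_subset_integral => //.
  - exact: (@measurable_KO_integrand 1).
  - by move=> x _; rewrite lee_fin KO_integrand_ge0.
  - by move=> x /=; rewrite !in_itv/= !andbT => tx; rewrite ltW// (le_lt_trans t1).
have -> : `]t, +oo[%classic = `]t, 1[ `|` `[1, +oo[ :> set R.
  apply/seteqP; split => x /=; rewrite !in_itv/= !andbT.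
    by move=> tx; have [x1|x1] := leP 1 x; [right|left; rewrite tx].
  by case=> [/andP[]//|]; exact: lt_le_trans.
rewrite ge0_integral_setU//=; last 3 first.
- apply: (@measurable_KO_integrand t) => //; first exact: measurableU.
  move=> x /=; rewrite !in_itv/= !andbT => -[/andP[/ltW]//|].
  by move=> x1; rewrite (le_trans (ltW t1)).
- by move=> x _; rewrite lee_fin KO_integrand_ge0.
- apply/disj_setPS => x /= []; rewrite !in_itv/= andbT => /andP[_ x1].
  by rewrite leNgt x1.
rewrite lte_add_pinfty//.
apply: (@le_lt_trans _ _ (\int[leb]_(z in `]t, 1%R[) (cst (f t)%:E z))%E).
  apply: ge0_le_integral => //.
  - by move=> x _; rewrite lee_fin KO_integrand_ge0.
  - apply: (@measurable_KO_integrand t) => // x /=.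
    by rewrite !in_itv/= andbT => /andP[/ltW].
  - move=> x /=; rewrite in_itv/= => /andP[tx _].
    by rewrite lee_fin KO_integrand_le// ltW.
rewrite integral_cst//= lebesgue_measure_itv/= lte_fin t1 -EFinD -EFinM ltry//.
Qed.

Lemma KO_GE t : 0 < t -> (KO_G m g t)%:E = (\int[leb]_(z in `]t, +oo[) (f z)%:E)%E.
Proof.
move=> t0; rewrite /KO_G /Rintegral fineK// ge0_fin_numE ?KO_G_fin//.
by apply: integral_ge0 => x _; rewrite lee_fin KO_integrand_ge0.
Qed.

Lemma KO_G_ge0 t : 0 <= KO_G m g t.
Proof.
apply: fine_ge0; apply: integral_ge0 => x _.
by rewrite lee_fin KO_integrand_ge0.
Qed.

(** The integrand is nonincreasing, hence at least its value at z on ]z/2, z]. *)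
Lemma KO_G_dyadic z : 0 < z -> z * f z / 2 + KO_G m g z <= KO_G m g (z / 2).
Proof.
move=> z0; have z20 : 0 < z / 2 by rewrite divr_gt0.
rewrite -lee_fin EFinD !KO_GE//.
have -> : `]z / 2, +oo[%classic = `]z / 2, z] `|` `]z, +oo[ :> set R.
  apply/seteqP; split => x /=; rewrite !in_itv/= !andbT.
    by move=> tx; have [x1|x1] := leP x z; [left; rewrite tx|right].
  by case=> [/andP[]//|]; lra.
rewrite [leRHS]ge0_integral_setU//=; last 3 first.
- apply: (@measurable_KO_integrand (z / 2)) => //; first exact: measurableU.
  move=> x /=; rewrite !in_itv/= !andbT => -[/andP[/ltW]//|].
  by lra.
- by move=> x _; rewrite lee_fin KO_integrand_ge0.
- apply/disj_setPS => x /= []; rewrite !in_itv/= andbT => /andP[_ x1].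
  by rewrite ltNge x1.
rewrite leeD2r//.
have -> : (z * f z / 2)%:E = (\int[leb]_(x in `](z / 2)%R, z]) (cst (f z)%:E x))%E.
  rewrite integral_cst//= lebesgue_measure_itv/= lte_fin ifT; last lra.
  by rewrite -EFinD -EFinM; congr (_%:E); field.
apply: ge0_le_integral => //.
- by move=> x _; rewrite lee_fin KO_integrand_ge0.
- apply: (@measurable_KO_integrand (z / 2)) => // x /=.
  by rewrite !in_itv/= andbT => /andP[/ltW].
- move=> x /=; rewrite in_itv/= => /andP[zx xz].
  by rewrite lee_fin KO_integrand_le// (lt_trans z20).
Qed.

Lemma KO_G_dyadic_sum z N : 0 < z ->
  \sum_(k < N) (z * 2 ^+ k) * f (z * 2 ^+ k) <= 2 * KO_G m g (z / 2).
Proof.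
elim: N z => [|N IH] z z0; first by rewrite big_ord0 mulr_ge0 ?KO_G_ge0.
rewrite big_ord_recl expr0 mulr1.
have := IH _ (mulr_gt0 z0 (ltr0n R 2)); rewrite mulfK ?pnatr_eq0// => h.
have {h} : \sum_(i < N) z * 2 ^+ bump 0 i * f (z * 2 ^+ bump 0 i) <= 2 * KO_G m g z.
  apply: le_trans h; rewrite le_eqVlt; apply/orP; left; apply/eqP.
  by apply: eq_bigr => i _; rewrite /bump leq0n add1n exprS mulrA.
have := KO_G_dyadic z0; lra.
Qed.

End keller_osserman_function.

(** * Iteration of the growth inequality *)

Section doubling.
Context {R : realType} (m n : nat) (g : R -> R).
Hypothesis m0 : (0 < m)%N.
Hypothesis g_mono : {in `[0, +oo[ &, {homo g : y z / y <= z}}.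
Hypothesis g_pos : forall z, 0 < z -> 0 < g z.
Hypothesis hint :
  (\int[@lebesgue_measure R]_(z in `[1%R, +oo[) (KO_integrand m g z)%:E < +oo)%E.
Variables (J : R -> R) (c z1 : R).
Hypothesis c0 : 0 < c.
Hypothesis J_ge0 : forall r, 0 <= J r.
Hypothesis J_le : forall r s, r <= s -> J r <= J s.
Hypothesis J_growth : forall R0 r h z0, 0 < R0 -> R0 <= r -> 0 < h -> r + h <= 2 * R0 ->
    0 < z0 -> z1 <= z0 -> z0 * R0 ^+ n <= c * h ^+ m.-1 * R0 * J r ->
    J r * (1 + c * h ^+ m * (g z0 / z0)) <= J (r + h).
Local Notation f := (KO_integrand m g).
Local Notation G := (KO_G m g).

Definition doubling_const : R := 8 * (1 + c^-1).

(** Otherwise the steps [h k] below sum to at most R0 and multiply J by 2^m each, so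
    that J would be infinite at 2 R0. *)
Lemma doubling_bound R0 zs : 0 < R0 -> 0 < J R0 -> 0 < zs -> z1 <= zs ->
  zs * R0 ^+ n <= c * 4 ^- m.-1 * R0 ^+ m * J R0 ->
  R0 < doubling_const * G (zs / 2).
Proof.
move=> R0_gt0 J0 zs0 z1s hzs; rewrite ltNge; apply/negP => hR.
pose C1 : R := 2 * (1 + c^-1).
have cp := c0.
have ci0 : 0 < c^-1 by rewrite invr_gt0.
have C10 : 0 < C1 by rewrite mulr_gt0// addr_gt0.
pose z k := zs * 2 ^+ k.
have z_gt0 k : 0 < z k by rewrite mulr_gt0 ?exprn_gt0.
pose w k := z k * f (z k).
have w_ge0 k : 0 <= w k by rewrite mulr_ge0 ?KO_integrand_ge0// ltW.
(* The first term keeps the level z k admissible, the second one forces J to grow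
   by the factor 2^m. *)
pose h k := R0 / 4 / 2 ^+ k + C1 * w k.
have hd k : 0 < R0 / 4 / 2 ^+ k by rewrite !divr_gt0 ?exprn_gt0.
have h_gt0 k : 0 < h k by rewrite ltr_wpDr// mulr_ge0// ltW.
pose r k := R0 + \sum_(i < k) h i.
have rS k : r k.+1 = r k + h k by rewrite /r big_ord_recr/= addrA.
have R0r k : R0 <= r k.
  by rewrite lerDl; apply: sumr_ge0 => i _; exact: ltW.
have geom k : \sum_(i < k) R0 / 4 / 2 ^+ i = R0 / 2 - R0 / 2 / 2 ^+ k.
  elim: k => [|k IH]; first by rewrite big_ord0 expr0 divr1 subrr.
  rewrite big_ord_recr/= IH exprS; field.
  by rewrite expf_neq0.
(* The geometric terms use up at most R0 / 2, the dyadic blocks of G the rest. *)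
have r2R k : r k <= 2 * R0.
  rewrite /r /h big_split/= geom -mulr_sumr.
  have hw : \sum_(i < k) w i <= 2 * G (zs / 2) by exact: KO_G_dyadic_sum.
  have : C1 * (\sum_(i < k) w i) <= C1 * (2 * G (zs / 2)) by rewrite ler_pM2l.
  have : C1 * (2 * G (zs / 2)) = doubling_const * G (zs / 2) / 2.
    by rewrite /C1 /doubling_const; field; rewrite gt_eqF.
  have : 0 <= R0 / 2 / 2 ^+ k by rewrite !divr_ge0 ?exprn_ge0// ltW.
  lra.
have Jr k : (2 ^+ k) ^+ m * J R0 <= J (r k).
  elim: k => [|k IH]; first by rewrite expr0 expr1n mul1r; exact: J_le.
  have hm1 : c * (R0 / 4 / 2 ^+ k) ^+ m.-1 * R0 * ((2 ^+ k) ^+ m * J R0) <=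
      c * h k ^+ m.-1 * R0 * J (r k).
    apply: ler_pM => //.
    - by rewrite !mulr_ge0 ?exprn_ge0// ltW.
    - by rewrite mulr_ge0 ?exprn_ge0// ltW.
    - rewrite ler_pM2r// ler_pM2l//; apply: lerXn2r;
        rewrite ?nnegrE ?(ltW (hd _)) ?(ltW (h_gt0 _))//.
      by rewrite lerDl mulr_ge0// ltW.
  have zk : z k * R0 ^+ n <= c * h k ^+ m.-1 * R0 * J (r k).
    apply: le_trans hm1; rewrite /z mulrAC.
    apply: (@le_trans _ _ (c * 4 ^- m.-1 * R0 ^+ m * J R0 * 2 ^+ k)).
      by rewrite ler_pM2r ?exprn_gt0.
    rewrite le_eqVlt; apply/orP; left; apply/eqP.
    rewrite -[in LHS](prednK m0) -[in X in _ = _ * (X * _)](prednK m0).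
    rewrite !expr_div_n !exprS.
    by field; rewrite !expf_neq0 ?pnatr_eq0.
  have z1z : z1 <= z k.
    by rewrite (le_trans z1s)// ler_peMr ?(ltW zs0)// exprn_ege1// ler1n.
  have rk := J_growth R0_gt0 (R0r k) (h_gt0 k).
  rewrite -rS in rk; have {rk} := rk _ (r2R k.+1) (z_gt0 k) z1z zk.
  apply: le_trans.
  have -> : (2 ^+ k.+1) ^+ m * J R0 = (2 ^+ k) ^+ m * J R0 * 2 ^+ m.
    by rewrite exprS exprMn; ring.
  apply: ler_pM => //; first by rewrite mulr_ge0 ?exprn_ge0// ltW.
  have gz : 0 < g (z k) / z k by rewrite divr_gt0// g_pos.
  apply: (@le_trans _ _ (c * (C1 * w k) ^+ m * (g (z k) / z k))); last first.
    apply: ler_wpDl => //; rewrite ler_pM2r// ler_pM2l//.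
    have Cw : 0 <= C1 * w k by rewrite mulr_ge0// ltW.
    apply: lerXn2r; rewrite ?nnegrE ?Cw ?(ltW (h_gt0 _))//.
    by rewrite /h lerDr ltW.
  rewrite exprMn /w KO_integrandX//.
  have -> : c * (C1 ^+ m * (z k / g (z k))) * (g (z k) / z k) = c * C1 ^+ m.
    by field; rewrite !gt_eqF// g_pos.
  rewrite /C1 exprMn mulrCA ler_peMr ?exprn_ge0//.
  apply: (@le_trans _ _ (c * (1 + c^-1))).
    by rewrite mulrDr mulfV ?gt_eqF// mulr1; lra.
  by rewrite ler_pM2l// ler_eXnr// lerDl ltW.
have bnd k : k%:R * J R0 <= J (2 * R0).
  apply: (@le_trans _ _ (J (r k))); last exact: J_le.
  apply: le_trans (Jr k); rewrite ler_pM2r//.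
  apply: (@le_trans _ _ (2 ^+ k)).
    by rewrite -natrX ler_nat ltnW// ltn_expl.
  by rewrite ler_eXnr// exprn_ege1// ler1n.
have := bnd (Num.truncn (J (2 * R0) / J R0)).+1.
rewrite leNgt -ltr_pdivrMr// truncnS_gt//.
Qed.

Let c4 : R := c * 4 ^- m.-1.

Let c4_gt0 : 0 < c4.
Proof. by rewrite mulr_gt0// invr_gt0 exprn_gt0. Qed.

Let C_gt0 : 0 < doubling_const.
Proof. by rewrite mulr_gt0// addr_gt0// invr_gt0. Qed.

(** A level Z that is admissible in [doubling_bound] for all large radii bounds these
    radii by a multiple of G(Z/2). *)
Lemma no_uniform_lower_bound Z R1 : 0 < Z -> z1 <= Z ->
  ~ forall R0, R1 <= R0 -> 0 < R0 ->
    0 < J R0 /\ Z * R0 ^+ n <= c * 4 ^- m.-1 * R0 ^+ m * J R0.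
Proof.
move=> Z0 z1Z H.
pose R0 := Num.max 1 (Num.max R1 (doubling_const * G (Z / 2))).
have R0_gt0 : 0 < R0 by rewrite lt_max ltr01.
have [J0 hZ] : 0 < J R0 /\ Z * R0 ^+ n <= c * 4 ^- m.-1 * R0 ^+ m * J R0.
  by apply: H => //; rewrite /R0 !le_max lexx orbT.
have := doubling_bound R0_gt0 J0 Z0 z1Z hZ.
by rewrite ltNge /R0 !le_max lexx !orbT.
Qed.

Hypothesis z1_le0 : z1 <= 0.

Lemma KO_G_lower_unbounded (N : nat) B R1 : n = (m + N)%N -> 0 < B -> 0 < R1 ->
  B <= J R1 -> forall R0, R1 <= R0 ->
  doubling_const^-1 * R0 <= G (c4 * B / 2 / R0 ^+ N).
Proof.
move=> nE B0 R1_gt0 BJ R0 R10; have R0_gt0 : 0 < R0 by exact: lt_le_trans R10.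
have BJ0 : B <= J R0 by rewrite (le_trans BJ)// J_le.
rewrite ler_pdivrMl// ltW// [c4 * B / 2 / _]mulrAC.
apply: doubling_bound => //.
- exact: lt_le_trans BJ0.
- by rewrite divr_gt0 ?mulr_gt0 ?exprn_gt0.
- by rewrite (le_trans z1_le0)// divr_ge0 ?mulr_ge0 ?exprn_ge0// ltW.
rewrite nE exprD -[X in _ <= X * _ * _]/c4.
rewrite (_ : _ / _ * _ = c4 * R0 ^+ m * B); last first.
  by field; rewrite expf_neq0// gt_eqF.
by rewrite ler_pM2l// mulr_gt0// exprn_gt0.
Qed.

(** The gain J(2R) - J(R) of a growth step with r = h = R becomes small, which forces
    z/g(z) to be large compared with R^m at the level z = c J(R1) R^-N. *)
Lemma KO_G_lower_bounded (N : nat) L R1 rho : n = (m + N)%N -> 0 < R1 -> 0 < J R1 ->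
  0 < rho -> (forall r, J r <= L) ->
  (forall e, 0 < e -> exists R2, forall r, R2 <= r -> L - e <= J r) ->
  exists R2, 0 < R2 /\ forall R0, R2 <= R0 -> rho * R0 <= G (c * J R1 / 2 / R0 ^+ N).
Proof.
move=> nE R1_gt0 J1 rho0 JL Lsup.
have cp := c0.
(* A growth step from R0 to 2 R0 that gains at most e forces
   z / g z >= (2 rho R0)^m. *)
pose e := c * J R1 / (2 * rho) ^+ m.
have e0 : 0 < e by rewrite divr_gt0 ?mulr_gt0// exprn_gt0 ?mulr_gt0.
have [R2 hR2] := Lsup e e0.
exists (Num.max R1 R2); split; first by rewrite lt_max R1_gt0.
move=> R0; rewrite ge_max => /andP[R10 R20].
have R0_gt0 : 0 < R0 by exact: lt_le_trans R10.
have J10 : J R1 <= J R0 by exact: J_le.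
have J0 : 0 < J R0 by exact: lt_le_trans J10.
pose z := c * J R1 / R0 ^+ N.
have z0 : 0 < z by rewrite divr_gt0 ?mulr_gt0 ?exprn_gt0.
have gz := g_pos z0.
have : J R0 * (1 + c * R0 ^+ m * (g z / z)) <= J (R0 + R0).
  apply: (J_growth (R0 := R0)) => //; first by lra.
    by rewrite (le_trans z1_le0)// ltW.
  rewrite nE exprD /z (_ : _ / _ * _ = c * R0 ^+ m * J R1); last first.
    by field; rewrite expf_neq0// gt_eqF.
  by rewrite -[in X in _ <= X](mulrA c) -exprSr prednK// ler_pM2l ?mulr_gt0 ?exprn_gt0.
rewrite mulrDr mulr1 => hJ.
have {}hJ : J R0 * (c * R0 ^+ m * (g z / z)) <= e.
  by have := hR2 _ R20; have := JL (R0 + R0); lra.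
have {}hJ : J R1 * (c * R0 ^+ m * (g z / z)) <= e.
  by apply: le_trans hJ; rewrite ler_pM2r// !mulr_gt0 ?exprn_gt0 ?invr_gt0.
have wm : (2 * rho * R0) ^+ m <= (z * f z) ^+ m.
  rewrite KO_integrandX// ler_pdivlMr// exprMn.
  have rm : 0 < (2 * rho) ^+ m by rewrite exprn_gt0 ?mulr_gt0.
  rewrite /e ler_pdivlMr// in hJ.
  have cJ2 : 0 < c * J R1 / z by rewrite divr_gt0// mulr_gt0.
  rewrite -(ler_pM2l cJ2) [leRHS](_ : _ = c * J R1); last by field; rewrite gt_eqF.
  apply: le_trans hJ; rewrite le_eqVlt; apply/orP; left; apply/eqP.
  by field; rewrite gt_eqF.
have wz : 2 * rho * R0 <= z * f z.
  have zf : 0 <= z * f z.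
    by apply: mulr_ge0; [exact: ltW|exact: KO_integrand_ge0].
  have rR : 0 <= 2 * rho * R0 by rewrite ltW// !mulr_gt0.
  by rewrite -(@ler_pXn2r _ m).
have := KO_G_dyadic m0 g_mono g_pos hint z0.
have := KO_G_ge0 m g z.
rewrite [c * J R1 / 2 / _]mulrAC -/z.
lra.
Qed.

(** Reparametrise t = kappa R0^-N. *)
Lemma near0_KO_G_ge (N : nat) kappa rho R1 M : (0 < N)%N ->
  0 < kappa -> 0 < rho -> 0 < R1 -> M <= rho ^+ N * kappa ->
  (forall R0, R1 <= R0 -> rho * R0 <= G (kappa / R0 ^+ N)) ->
  \forall t \near 0^'+, M <= G t ^+ N * t.
Proof.
move=> N0 k0 rho0 R1_gt0 hM H; near=> t.
have t0 : 0 < t by near: t; exact: nbhs_right_gt.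
have tk : t < kappa / R1 ^+ N.
  by near: t; apply: nbhs_right_lt; rewrite divr_gt0// exprn_gt0.
have kt : 0 < kappa / t by rewrite divr_gt0.
pose R0 := (kappa / t) `^ N%:R^-1.
have R0N : R0 ^+ N = kappa / t.
  rewrite -powR_mulrn ?powR_ge0// -powRrM mulVf ?pnatr_eq0 -?lt0n//.
  by rewrite powRr1// ltW.
have R0_gt0 : 0 < R0 by rewrite powR_gt0.
have R10 : R1 <= R0.
  rewrite -(@ler_pXn2r _ N)// ?nnegrE ?(ltW R0_gt0) ?(ltW R1_gt0)// R0N.
  by rewrite ler_pdivlMr// mulrC -ler_pdivlMr ?exprn_gt0// ltW.
have := H _ R10; rewrite R0N invfM invrK mulrA mulfV ?gt_eqF// mul1r => hG.
apply: le_trans hM _.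
rewrite (_ : kappa = R0 ^+ N * t); last by rewrite R0N divfK// gt_eqF.
rewrite mulrA ler_pM2r// -exprMn; apply: lerXn2r => //; rewrite nnegrE.
  by rewrite mulr_ge0 ?ltW.
exact: KO_G_ge0.
Unshelve. all: by end_near. Qed.

(** Both cases supply kappa and rho with rho^N kappa >= M: an unbounded J allows a large
    kappa for fixed rho, a bounded J allows a large rho for fixed kappa. *)
Lemma near0_KO_G_unbounded (N : nat) R1 : n = (m + N)%N -> (0 < N)%N ->
  0 < R1 -> 0 < J R1 -> forall M, \forall t \near 0^'+, M <= G t ^+ N * t.
Proof.
move=> nE N0 R1_gt0 J1 M.
have cp := c0; have c4p := c4_gt0; have Cp := C_gt0.
have [[L hL]|Junb] := pselect (exists L, forall r, J r <= L); last first.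
  pose B := 2 * (doubling_const ^+ N / c4) * Num.max 1 M.
  have M1 : 0 < Num.max 1 M by rewrite lt_max ltr01.
  have CN : 0 < doubling_const ^+ N by rewrite exprn_gt0.
  have B0 : 0 < B by rewrite !mulr_gt0 ?invr_gt0.
  have [R2 [R2_gt0 BR2]] : exists R2, 0 < R2 /\ B <= J R2.
    apply: contrapT => /forallNP H; apply: Junb; exists B => r.
    rewrite leNgt; apply/negP => Br; apply: (H (Num.max 1 r)).
    rewrite lt_max ltr01; split => //.
    by rewrite (le_trans (ltW Br))// J_le// le_max lexx orbT.
  apply: (@near0_KO_G_ge N (c4 * B / 2) doubling_const^-1 R2) => //.
  - by rewrite !mulr_gt0 ?invr_gt0.
  - by rewrite invr_gt0.
  - rewrite (_ : _ * _ = Num.max 1 M); first by rewrite le_max lexx orbT.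
    by rewrite /B exprVn; field; rewrite !gt_eqF.
  - exact: KO_G_lower_unbounded.
pose S := range J.
have supS : has_sup S by split; [exists (J 0), 0|exists L => _ [r _ <-]].
pose rho := Num.max 1 (M / (c * J R1 / 2)).
have k0 : 0 < c * J R1 / 2 by rewrite !mulr_gt0.
have rho1 : 1 <= rho by rewrite le_max lexx.
have rho0 : 0 < rho by exact: lt_le_trans rho1.
have [||R2 [R2_gt0 hR2]] := @KO_G_lower_bounded N (sup S) R1 rho nE R1_gt0 J1 rho0.
- by move=> r; apply: ub_le_sup; [exact: supS.2|exists r].
- move=> e e0; have [_ [r _ <-] hr] := sup_adherent e0 supS.
  by exists r => s rs; rewrite (le_trans (ltW hr))// J_le.
apply: (@near0_KO_G_ge N (c * J R1 / 2) rho R2) => //.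
apply: (@le_trans _ _ (rho * (c * J R1 / 2))).
  by rewrite -ler_pdivrMr// le_max lexx orbT.
by rewrite ler_pM2r// ler_eXnr.
Qed.

End doubling.

Lemma limf_einf_infty (R : realType) (f : R -> R) (F : set_system R) :
  (forall M, \forall t \near F, M <= f t) -> limf_einf (fun t => (f t)%:E) F = +oo%E.
Proof.
move=> H; rewrite /limf_einf /=; apply/eqP; rewrite eqe_oppLR/=.
rewrite -leeNy_eq; apply: le_trans (lexx _).
have bnd (M : R) : (limf_esup (\- (fun t => (f t)%:E))%E F <= (- M)%:E)%E.
  apply: (@le_trans _ _ (ereal_sup [set (- (f x)%:E)%E | x in [set t | M <= f t]])).
    by apply: ereal_inf_lbound; exists [set t | M <= f t] => //; exact: H.
  apply: ge_ereal_sup => _ [t /= ht <-].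
  by rewrite lee_fin lerN2.
case: (limf_esup _ _) bnd => [r| |] bnd //.
- by have := bnd (- r + 1); rewrite lee_fin => h; exfalso; lra.
- by have := bnd 0.
Qed.

(** * Convex profiles *)

Section convex_profile.
Context {R : realType} (g : R -> R).
Hypothesis g_mono : {in `[0, +oo[ &, {homo g : y z / y <= z}}.
Hypothesis g_convex : convex_function (`[0, +oo[%classic : set R) g.
Hypothesis g_pos : forall z, 0 < z -> 0 < g z.

Lemma convex_ineq x y t : 0 <= x -> 0 <= y -> 0 <= t <= 1 ->
  g (t * x + (1 - t) * y) <= t * g x + (1 - t) * g y.
Proof.
move=> x0 y0 /andP[t0 t1].
by apply: (g_convex (Itv01 t0 t1)); rewrite inE/= in_itv/= andbT.
Qed.

Lemma convex_chord z z' : 0 < z -> z <= z' ->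
  (g z - g 0) * z' <= (g z' - g 0) * z.
Proof.
move=> z0 zz'; have z'0 : 0 < z' by exact: lt_le_trans zz'.
have t01 : 0 <= z / z' <= 1.
  by rewrite divr_ge0 ?(ltW z0) ?(ltW z'0)//= ler_pdivrMr// mul1r.
have := convex_ineq (ltW z'0) (lexx 0) t01.
rewrite mulr0 addr0 divfK ?gt_eqF// => h.
rewrite -ler_pdivlMr//; apply: (@le_trans _ _ (z / z' * (g z' - g 0))); first lra.
by rewrite le_eqVlt; apply/orP; left; apply/eqP; ring.
Qed.

(** A convex function that is negative at 0 stays negative near 0. *)
Lemma convex_profile_ge0 : 0 <= g 0.
Proof.
rewrite leNgt; apply/negP => g0.
have g1 := g_pos ltr01.
have d0 : 0 < g 1 - g 0 by lra.
pose t := - g 0 / (2 * (g 1 - g 0)).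
have t0 : 0 < t by rewrite divr_gt0 ?mulr_gt0// oppr_gt0.
have t1 : t <= 1 by rewrite ler_pdivrMr ?mulr_gt0//; lra.
have := @convex_ineq 1 0 t ler01 (lexx 0) _; rewrite (ltW t0) t1 => /(_ isT).
rewrite mulr0 addr0 mulr1.
have -> : t * g 1 + (1 - t) * g 0 = g 0 / 2.
  by rewrite /t; field; rewrite gt_eqF.
have := g_pos t0; lra.
Qed.

Lemma profile_ge0 z : 0 <= z -> 0 <= g z.
Proof.
move=> z0; apply: le_trans convex_profile_ge0 _.
by apply: g_mono; rewrite ?in_itv/= ?lexx ?andbT.
Qed.

(** The chord slopes (g(z) - g(0))/z are nondecreasing, and g(z) - g(0) is at least half
    of g(z) once g(z) >= 2 g(0). *)
Lemma convex_quasi_superlinear z1 : (0 < g 0 -> 2 * g 0 <= g z1) -> 0 <= z1 ->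
  forall z z', z1 <= z -> 0 < z -> z <= z' -> g z * z' <= 2 * (g z' * z).
Proof.
move=> gz1 z10 z z' zz1 z0 zz'.
have h := convex_chord z0 zz'.
have g0 := convex_profile_ge0.
have z'0 : 0 < z' by exact: lt_le_trans zz'.
have g2 : g z <= 2 * (g z - g 0).
  move: g0; rewrite le_eqVlt => /predU1P[<-|g0].
    by have := g_pos z0; lra.
  have : g z1 <= g z by apply: g_mono; rewrite ?in_itv/= ?andbT ?(ltW z0).
  by have := gz1 g0; lra.
apply: (@le_trans _ _ (2 * (g z - g 0) * z')); first by rewrite ler_pM2r.
have : 0 <= g 0 * z by rewrite mulr_ge0// ltW.
nra.
Qed.

(** If g were bounded, (z/g(z))^(1/m) would be bounded below for z >= 1, and the dyadic
    blocks of the integral would not be summable. *)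
Lemma profile_unbounded m B : (0 < m)%N ->
  (\int[@lebesgue_measure R]_(z in `[1%R, +oo[) (KO_integrand m g z)%:E < +oo)%E ->
  0 < B -> exists2 z, 0 < z & B <= g z.
Proof.
move=> m0 hint B0; apply: contrapT => H.
have gB z : 0 < z -> g z <= B.
  move=> z0; rewrite leNgt; apply/negP => Bg; apply: H.
  by exists z => //; exact: ltW.
pose e := Num.min 1 B^-1.
have e0 : 0 < e by rewrite lt_min ltr01 invr_gt0.
have e1 : e <= 1 by rewrite ge_min lexx.
have we k : e <= 1 * 2 ^+ k * KO_integrand m g (1 * 2 ^+ k).
  set z := 1 * 2 ^+ k.
  have z1 : 1 <= z by rewrite /z mul1r exprn_ege1// ler1n.
  have z0 : 0 < z by exact: lt_le_trans z1.
  have w0 : 0 <= z * KO_integrand m g z by rewrite mulr_ge0 ?KO_integrand_ge0// ltW.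
  rewrite -(@ler_pXn2r _ m)// ?nnegrE ?(ltW e0)// KO_integrandX//.
  apply: (@le_trans _ _ e).
    by rewrite -(prednK m0) exprS ger_pMr// exprn_ile1// ltW.
  apply: (@le_trans _ _ B^-1); first by rewrite ge_min lexx orbT.
  rewrite ler_pdivlMr ?g_pos// mulrC ler_pdivrMr//.
  by rewrite (le_trans (gB _ z0))// ler_peMl// ltW.
pose N := (Num.truncn (2 * KO_G m g (1 / 2) / e)).+1.
have := KO_G_dyadic_sum m0 g_mono g_pos hint N ltr01.
apply/negP; rewrite -ltNge.
apply: (@lt_le_trans _ _ (\sum_(k < N) e)).
  by rewrite sumr_const card_ord -[ltRHS]mulr_natl -ltr_pdivrMr// truncnS_gt.
by apply: ler_sum => k _; exact: we.
Qed.

End convex_profile.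

(** * Triviality of global weak solutions *)

Theorem theorem2p1 (R : realType) (m n : nat) (hm : (0 < m)%N) (hn : (0 < n)%N)
    (a : multi_index n m -> 'rV[R]_n -> R -> R)
    (ha : forall alpha, mi_order alpha = m -> caratheodory_function (a alpha))
    (A : R) (hA : 0 < A)
    (haA : forall alpha, mi_order alpha = m ->
      {ae lebesgue_rV R n, forall x, forall z, `|a alpha x z| <= A * `|z|})
    (g : R -> R)
    (g_mono : {in `[0, +oo[ &, {homo g : y z / y <= z}})
    (g_convex : convex_function (`[0, +oo[%classic : set R) g)
    (g_pos : forall z, 0 < z -> 0 < g z)
    (hint : (\int[lebesgue_measure]_(z in `[1%R, +oo[)
               (KO_integrand m g z)%:E < +oo)%E)
    (hliminf : (limf_einf
        (fun t : R => (KO_G m g t ^ (n%:Z - m%:Z) * t)%:E) 0^'+ < +oo)%E)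
    (u : 'rV[R]_n -> R) (hu : global_weak_solution a g u) :
  {ae lebesgue_rV R n, forall x, u x = 0}.
Proof.
have g0 := profile_ge0 g_mono g_convex g_pos.
have [lu lgu _] := hu.
pose J := source_massR g u.
have J_ge0 : forall r, 0 <= J r by exact: source_massR_ge0.
have J_le : forall r s, r <= s -> J r <= J s by exact: source_massR_le.
apply: (source_massR_eq0 g0 lgu g_pos) => r0 r0_gt0; apply: contrapT => Jr0.
have {}Jr0 : 0 < J r0 by rewrite lt_def J_ge0 andbT; apply/eqP.
(* The level above which g z / z is almost nondecreasing; it is 0 when g 0 = 0, since
   small levels matter in that case. *)
have [z1 [z1_ge0 z1E gz1]] : exists z1, [/\ 0 <= z1, (g 0 = 0 -> z1 = 0) &
    (0 < g 0 -> 2 * g 0 <= g z1)].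
  have [->|g00] := eqVneq (g 0) 0; first by exists 0; rewrite ltxx.
  have g0p : 0 < g 0 by rewrite lt_def g00 g0.
  have [z z0 hz] := profile_unbounded g_mono g_pos hm hint (mulr_gt0 (ltr0n R 2) g0p).
  by exists z; split => [|/eqP|//]; [exact: ltW|rewrite (negbTE g00)].
have quasi := convex_quasi_superlinear g_mono g_convex g_pos gz1 z1_ge0.
have [c [c0 growth]] := source_massR_growth g0 lu lgu hm hn hA haA hu quasi.
pose c4 : R := c * 4 ^- m.-1.
have c4_gt0 : 0 < c4 by rewrite mulr_gt0// invr_gt0 exprn_gt0.
have no_bound := no_uniform_lower_bound hm g_mono g_pos hint c0 J_ge0 J_le growth.
have [g00|g00] := eqVneq (g 0) 0; last first.
  have g0p : 0 < g 0 by rewrite lt_def g00 g0.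
  have z1_gt0 : 0 < z1.
    rewrite lt_def z1_ge0 andbT; apply: contraTneq (gz1 g0p) => ->.
    by rewrite -ltNge; lra.
  pose q := c4 * (g 0 * 2 ^+ n).
  have q0 : 0 < q by rewrite !mulr_gt0 ?exprn_gt0.
  apply: (no_bound z1 (Num.max 1 (z1 / q)) z1_gt0 (lexx _)) => R0.
  rewrite ge_max => /andP[R01 zR0] R0_gt0.
  have JR0 : g 0 * (2 * R0) ^+ n <= J R0.
    apply: (source_massR_lower g0 lgu); [exact: ltW|exact: g0|].
    by move=> z z0; apply: g_mono; rewrite ?in_itv/= ?lexx ?andbT.
  split; first by apply: lt_le_trans JR0; rewrite mulr_gt0 ?exprn_gt0 ?mulr_gt0.
  rewrite -/c4.
  apply: (@le_trans _ _ (c4 * R0 ^+ m * (g 0 * (2 * R0) ^+ n))); last first.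
    by rewrite ler_pM2l// mulr_gt0 ?exprn_gt0.
  rewrite exprMn (_ : c4 * _ * _ = q * R0 ^+ m * R0 ^+ n); last by rewrite /q; ring.
  rewrite ler_pM2r ?exprn_gt0//; rewrite ler_pdivrMr// in zR0.
  by rewrite (le_trans zR0)// mulrC ler_pM2l// ler_eXnr.
have z1_eq0 := z1E g00.
have [nm|mn] := leqP n m.
  have Z0 : 0 < c4 * J r0 by rewrite mulr_gt0.
  apply: (no_bound (c4 * J r0) (Num.max 1 r0) Z0); first by rewrite z1_eq0 ltW.
  move=> R0; rewrite ge_max => /andP[R01 r0R0] R0_gt0.
  have Jr0R0 : J r0 <= J R0 by exact: J_le.
  split; first exact: lt_le_trans Jr0R0.
  rewrite -/c4 [leLHS](_ : _ = c4 * (R0 ^+ n * J r0)); last by ring.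
  rewrite -(mulrA c4) ler_pM2l//; apply: ler_pM => //.
    by rewrite exprn_ge0// ltW.
  by apply: ler_weXn2l.
have nE : n = (m + (n - m))%N by rewrite subnKC// ltnW.
have z1_le0 : z1 <= 0 by rewrite z1_eq0.
have near0 := near0_KO_G_unbounded hm g_mono g_pos hint c0 J_ge0 J_le growth
  z1_le0 nE _ r0_gt0 Jr0.
move: hliminf; rewrite limf_einf_infty// => M.
rewrite subzn; last exact: ltnW.
by apply: near0; rewrite subn_gt0.
Qed.
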